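(* Let $m\ge0$ and $k\ge1$ be integers and let $P_{mk}$ be the polynomials over a field of characteristic $0$ defined by $$\sum_{k=1}^{\infty}P_{mk}(x_0,x_1,\dots,x_{m+k})z^k=\frac{\sqrt{\sum_{k=0}^{\infty}x_kx_0^{k-1}z^k}-\sqrt{\sum_{k=0}^{m}x_kx_0^{k-1}z^k}}{x_0^mz^m}.$$ Then: (1) $P_{mk}$ is homogeneous of degree $k$ and isobaric of weight $m+k$ (where $x_i$ has weight $i$). (2) $$P_{mk}(x_0,\dots,x_{m+k})=\sum_{\substack{\pi\vdash m+k\\ \pi_1>m}}\binom{1/2}{p_1,\dots,p_{m+k}}x_0^{p_0}x_1^{p_1}\cdots x_{m+k}^{p_{m+k}},$$ where $\pi=(1^{p_1}2^{p_2}\dots)$ runs over partitions of $m+k$ with largest part $\pi_1>m$, and $p_0=k-\ell(\pi)$, $\ell(\pi)$ being the length of $\pi$. (3) The least common multiple of the denominators of the coefficients of $P_{mk}$ equals $2^{2k-s(k)}$ if $m=0$ and $2^{2k-s(k-1)-1}$ if $m>0$, where $s(k)$ is the sum of the binary digits of $k$. (4) With $x=(x_{m+1},\dots,x_{m+k})$, $dx=(dx_{m+1},\dots,dx_{m+k})$, $$P_{mk}(x_0,\dots,x_{m+k})=\frac{(-1)^{k-1}}{(2k-2)!!\cdot2}\int_0^x\det\binom{dx}{A},$$ where $A$ is the $(k-1)\times k$ matrix $$A=\begin{pmatrix}(2k-2)x_0&(2k-3)x_1&\dots&kx_{k-2}&(k-1)x_{k-1}\\0&(2k-4)x_0&\dots&(k-1)x_{k-3}&(k-2)x_{k-2}\\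 \vdots&&&&\vdots\\0&0&\dots&2x_0&x_1\end{pmatrix}.$$ (5) $P_{0k}(x_0,\dots,x_k)=\frac{(-1)^{k-1}}{(2k)!!}\det\binom{x'}{A}$ with $x'=(x_1,2x_2,\dots,kx_k)$. (6) If $m\ge k-1$, then $P_{mk}(x_0,\dots,x_{m+k})=\frac{(-1)^{k-1}}{(2k-2)!!\cdot2}\det\binom{x}{A}$ with $x=(x_{m+1},\dots,x_{m+k})$. (7) $P_{m1}=\frac12x_{m+1}$; $P_{02}=\frac18(4x_0x_2-x_1^2)$; $P_{m2}=\frac14(2x_0x_{m+2}-x_1x_{m+1})$ for $m\ge1$; $P_{03}=\frac1{16}(8x_0^2x_3-4x_0x_1x_2+x_1^3)$; $P_{13}=\frac1{16}(8x_0^2x_4-2x_0(2x_1x_3+x_2^2)+3x_1^2x_2)$; $P_{m3}=\frac1{16}(8x_0^2x_{m+3}-4x_0(x_1x_{m+2}+x_2x_{m+1})+3x_1^2x_{m+1})$ for $m\ge2$; $P_{04}=\frac1{128}(64x_0^3x_4-16x_0^2(2x_1x_3+x_2^2)+24x_0x_1^2x_2-5x_1^4)$; $P_{14}=\frac1{32}(16x_0^3x_5-8x_0^2(x_1x_4+x_2x_3)+6x_0(x_1^2x_3+x_1x_2^2)-5x_1^3x_2)$; $P_{24}=\frac1{32}(16x_0^3x_6-4x_0^2(2x_1x_5+2x_2x_4+x_3^2)+6x_0(x_1^2x_4+2x_1x_2x_3)-5x_1^3x_3)$; $P_{m4}=\frac1{32}(16x_0^3x_{m+4}-8x_0^2(x_1x_{m+3}+x_2x_{m+2}+x_3x_{m+1})+6x_0(x_1^2x_{m+2}+2x_1x_2x_{m+1})-5x_1^3x_{m+1})$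 for $m\ge3$. (8) $P_{0k}(1,1,\dots,1)=\frac{(2k-1)!!}{(2k)!!}$, and $P_{mk}(1,1,\dots,1)=\frac{(2k-3)!!}{(2k-2)!!\cdot2}$ for $m\ge k-1$. (9) If $m=0$, the sum in (2) has $p(k)$ nonzero terms, where $p(k)$ is the number of partitions of $k$. If $m\ge k-1$, the sum in (2) has $p(0)+p(1)+\dots+p(k-1)$ nonzero terms.
   Context: Square roots of series in $z$ with constant term $1$ (note $x_0x_0^{-1}=1$) are the series with constant term $1$. For $a$ in a field of characteristic $0$ and nonnegative integers $p_1,\dots,p_r$ with $\ell=p_1+\dots+p_r$, $\binom{a}{p_1,\dots,p_r}=\frac{a(a-1)\cdots(a-\ell+1)}{p_1!\cdots p_r!}$. $\binom{v}{A}$ denotes the $k\times k$ matrix obtained by adding the row $v$ on top of $A$; for $k=1$, $A$ is empty. Row $r$ of $A$ ($1\le r\le k-1$) has, in column $c\ge r$, the entry $(2(k-r)-(c-r))x_{c-r}$, and $0$ in columns $c<r$. In (4), $x_0,\dots,x_m$ are treated as constants, $\det\binom{dx}{A}$ is a polynomial differential 1-form in $x_{m+1},\dots,x_{m+k}$, and $\int_0^x$ denotes its line integral from $0$ to $x$, i.e. the polynomial in $x_{m+1},\dots,x_{m+k}$ vanishing at $x_{m+1}=\dots=x_{m+k}=0$ whose differential is this form. Double factorials: $0!!=(-1)!!=1$. *)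

(* Defs.v *)
(* MathComp, with the multinomials library. *)
From mathcomp Require Export all_boot all_order all_algebra.
From mathcomp.multinomials Require Export mpoly.
(* monalg redefines many names and notations of mpoly, so that only its
   structures are imported. *)
From mathcomp.multinomials Require Export (canonicals, coercions) monalg.

Set Implicit Arguments.
Unset Strict Implicit.
Unset Printing Implicit Defensive.

Import GRing.Theory.
Local Open Scope ring_scope.

(* A power series in z over R is the sequence of its coefficients. *)
Section PowerSeries.
Variable R : comNzRingType.
Implicit Types f g x : nat -> R.

Definition series_mul f g : nat -> R :=
  fun n => \sum_(i < n.+1) f i * g (n - i)%N.

(* g is the square root of f with constant term 1. *)
Definition is_series_sqrt f g : Prop := g 0%N = 1 /\ series_mul g g =1 f.

(* sum_k x_k x_0^(k-1) z^k, whose constant term x_0 x_0^-1 is 1. *)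
Definition radicand x : nat -> R :=
  fun k => if k is j.+1 then x k * x 0%N ^+ j else 1.

Definition truncation m f : nat -> R := fun k => if (k <= m)%N then f k else 0.

(* c z^m *)
Definition series_monomial c m : nat -> R := fun n => if n == m then c else 0.
End PowerSeries.

(* F[x_0, x_1, x_2, ...] *)
Definition infpoly (F : fieldType) := monalg.malg (monalg.cmonom nat) F.
Definition infvar (F : fieldType) (i : nat) : infpoly F :=
  monalg.mkmalgU (monalg.ucm i) 1.

(* The variables of {mpoly F[N.+1]} are x_0, ..., x_N; x_ i is meant to be used
   for i <= N only. *)
Definition x_ {F : fieldType} {N : nat} (i : nat) : {mpoly F[N.+1]} :=
  'X_(inord i).

(* p(x_0, ..., x_N) as an element of F[x_0, x_1, x_2, ...] *)
Definition embed (F : fieldType) N (p : {mpoly F[N.+1]}) : infpoly F :=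
  mmap (fun c : F => c%:A : infpoly F) (fun i : 'I_N.+1 => infvar F i) p.

(* The defining identity of the P_{mk}, multiplied by x_0^m z^m. The values
   P m 0 do not occur in it. *)
Definition is_sqrt_family (F : fieldType)
    (P : forall m k : nat, {mpoly F[(m + k).+1]}) : Prop :=
  forall m, exists u v : nat -> infpoly F,
  [/\ is_series_sqrt (radicand (infvar F)) u,
      is_series_sqrt (truncation m (radicand (infvar F))) v &
      series_mul (series_monomial (infvar F 0 ^+ m) m)
                 (fun k => if k is 0%N then 0 else embed (P m k))
      =1 (fun n => u n - v n)].

Definition isobaric (F : fieldType) N (w : nat) (p : {mpoly F[N]}) : Prop :=
  {in msupp p, forall e : 'X_{1..N}, (\sum_(i < N) i * e i)%N = w}.

(* A partition of n is the weakly decreasing sequence of its parts; it has at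
   most n parts, all of them at most n. *)
Definition parts n (pi : n.-bseq 'I_n.+1) : seq nat := map val pi.

Definition partitions n : {set n.-bseq 'I_n.+1} :=
  [set pi | [&& sorted geq (parts pi), all (ltn 0%N) (parts pi)
              & sumn (parts pi) == n]].

Definition largest_part n (pi : n.-bseq 'I_n.+1) : nat := head 0%N (parts pi).

Definition multiplicity n (pi : n.-bseq 'I_n.+1) (i : nat) : nat :=
  count_mem i (parts pi).

Definition gen_multinomial (F : fieldType) (a : F) (p : seq nat) : F :=
  (\prod_(i < sumn p) (a - i%:R)) / \prod_(q <- p) (q`!)%:R.

Definition expansion_term (F : fieldType) m k
    (pi : (m + k).-bseq 'I_(m + k).+1) : {mpoly F[(m + k).+1]} :=
  gen_multinomial (2%:R^-1) [seq multiplicity pi i | i <- iota 1 (m + k)]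
  *: (x_ 0 ^+ (k - size pi)
      * \prod_(1 <= i < (m + k).+1) x_ i ^+ multiplicity pi i).

(* In characteristic 0, ratr is injective, so that q is unique. *)
Definition is_lcm_denominators (F : fieldType) N (p : {mpoly F[N]}) (L : nat) :=
  exists q : 'X_{1..N} -> rat,
    (forall e, p@_e = ratr (q e))
    /\ L = \big[lcmn/1%N]_(e <- msupp p) `|denq (q e)|%N.

(* All binary digits of k are at positions < k. *)
Definition binary_digit_sum (k : nat) : nat :=
  (\sum_(i < k) (k %/ 2 ^ i) %% 2)%N.

Fixpoint double_fact (n : nat) : nat :=
  if n is n'.+2 then (n * double_fact n')%N else 1%N.

Section Determinants.
Variable R : comNzRingType.

(* The matrix A for k = n.+1: the row of index i is row r = i.+1, the column
   of index j is column c = j.+1, and k - r = n - i, c - r = j - i. *)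
Definition A_mx n (x : nat -> R) : 'M[R]_(n, n.+1) :=
  \matrix_(i < n, j < n.+1)
    if (i <= j)%N then (2 * (n - i) - (j - i))%:R * x (j - i)%N else 0.

Definition det_top n (v : 'rV[R]_n.+1) (A : 'M[R]_(n, n.+1)) : R :=
  \det (col_mx v A : 'M[R]_n.+1).
End Determinants.

(* Differential forms in x_{m+1}, ..., x_{m+k}, with x_0, ..., x_m as constants:
   a 1-form is a linear polynomial in k further variables
   dx_{m+1}, ..., dx_{m+k} over F[x_0, ..., x_{m+k}]. *)
Section Forms.
Variables (F : fieldType) (m k : nat).
Local Notation R := {mpoly F[(m + k).+1]}.

Definition differential (p : R) : {mpoly R[k]} :=
  \sum_(j < k) p^`M(inord (m + j.+1)) *: 'X_j.

Definition at_origin (p : R) : R :=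
  p \mPo [tuple if (i <= m)%N then 'X_i else 0 | i < (m + k).+1].

Definition is_line_integral (omega : {mpoly R[k]}) (p : R) : Prop :=
  differential p = omega /\ at_origin p = 0.
End Forms.

(* det(dx; A) for k = n.+1 *)
Definition dx_form (F : fieldType) m n :
    {mpoly {mpoly F[(m + n.+1).+1]}[n.+1]} :=
  det_top (\row_j 'X_j) (map_mx (@mpolyC n.+1 _) (A_mx n x_)).

(* Main.v *)
From mathcomp Require Import ring zify.
From mathcomp Require Import (canonicals, coercions) finmap.
Require Import Defs.

(** Let y be the radicand, with coefficients y_0 = 1 and y_i = x_i x_0^(i-1) for
    i > 0, let u be its square root, and v the square root of its truncation.

    Over a field of characteristic 0, the power y^a of a series with constant
    term 1 can be defined by the multinomial formula: its coefficient of z^n is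
    the sum of binom(a; p_1, p_2, ...) times the product of the y_i^p_i over the
    partitions (1^p_1 2^p_2 ...) of n. Removing a part from a partition gives
    the differential equation z (y^a)' = a z y' y^(a-1) ([euler_binom_series]),
    from which the law y^a y^b = y^(a+b) follows by induction on the degree
    ([binom_seriesD]).
    Hence u = y^(1/2), its inverse is w = y^(-1/2), and u - v consists of the
    terms of the partitions with a part larger than m ([sqrt_diffE]). Since
    square roots with constant term 1 are unique and x_0 is not a zero divisor,
    this is the partition formula for P_mk ([sqrt_familyE], [sqrt_polyE]).
    Degree, weight, coefficients and number of terms are read off from it.

    The three determinants are linear in their first row, and so are three
    expressions of P_mk by the coefficients of w. One has 2 z u' = z y' w, and
    2 D u = w D y for every derivation D ([derivation_sqrt]); moreover 2 (u - v)
    and (y - v^2) w agree up to degree 2 m + 1, as (u - v)^2 starts in degree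
    2 m + 2 ([sqrt_diff_small]). For k = n + 1, these identities write P_0k,
    the differential of P_mk, and P_mk for m >= n as multiples of the sums over
    j of v_j x_0^j w_(n-j), where v_j is (j+1) x_(j+1), dx_(m+j+1) and x_(m+j+1)
    respectively. On the other hand the vector of the x_0^j w_(n-j) spans the
    kernel of the matrix A: this is the differential equation
    2 y w' + y' w = 0. So the determinant with the row v on top of A is, up to
    the explicit factor (-1)^n (2n)!!, the sum of the v_j x_0^j w_(n-j)
    ([det_topE]).

    If all x_i are 1, then y = 1 / (1 - z), whose square root has the
    coefficients (2n-1)!! / (2n)!! ([sqrt_geometric]).

    As for denominators, the coefficient at a partition of length l is an odd
    integer divided by 2^l and by the 2-part of the product of the p_i!
    ([binom_coef_half]), because l! divides 2^(l-1) (2l-3)!!. The product of the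
    p_i! divides l!, and l <= k, so that for m = 0 the exponent of 2 is at most
    that of 2^k k!. If m > 0 and l = k, the largest part occurs once and
    k! improves to (k-1)!. The partition (m+1, 1, ..., 1) attains the bound, and
    Legendre's formula rewrites it by binary digits. *)

Set Implicit Arguments.
Unset Strict Implicit.
Unset Printing Implicit Defensive.

Import GRing.Theory.
Local Open Scope ring_scope.

(** * Convolution of power series *)

Section SeriesTheory.
Variable R : comNzRingType.
Implicit Types f g h : nat -> R.

Lemma eq_series_mul n f f' g g' :
    (forall i, (i <= n)%N -> f i = f' i) ->
    (forall i, (i <= n)%N -> g i = g' i) ->
  series_mul f g n = series_mul f' g' n.
Proof.
move=> eqf eqg; apply: eq_bigr => i _.
by rewrite eqf ?eqg ?leq_subr // -ltnS.
Qed.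

(** Convolution inherits commutativity and associativity from the product of
    the polynomials that agree with the series up to the degree considered. *)
Lemma coef_mul_poly N n f g : (n <= N)%N ->
  ((\poly_(i < N.+1) f i) * (\poly_(i < N.+1) g i))`_n = series_mul f g n.
Proof.
move=> le_nN; rewrite coefM; apply: eq_bigr => i _; rewrite !coef_poly !ltnS.
by rewrite (leq_trans _ le_nN) ?(leq_trans _ le_nN) ?leq_subr // -ltnS.
Qed.

Lemma series_mulC f g n : series_mul f g n = series_mul g f n.
Proof. by rewrite -!(coef_mul_poly _ _ (leqnn n)) mulrC. Qed.

Lemma series_mulA f g h n :
  series_mul f (series_mul g h) n = series_mul (series_mul f g) h n.
Proof.
pose T f := \poly_(i < n.+1) f i; transitivity ((T f * T g * T h)`_n).
  rewrite -mulrA coefM; apply: eq_bigr => i _.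
  by rewrite coef_mul_poly ?leq_subr // coef_poly ltn_ord.
rewrite coefM; apply: eq_bigr => i _.
by rewrite coef_mul_poly -1?ltnS // coef_poly ltnS leq_subr.
Qed.

Lemma series_mul0 f g : series_mul f g 0 = f 0%N * g 0%N.
Proof. by rewrite /series_mul big_ord1. Qed.

Lemma series_mul_monomial c m f n :
  series_mul (series_monomial c m) f n
  = if (m <= n)%N then c * f (n - m)%N else 0.
Proof.
rewrite /series_mul /series_monomial; case: ifP => [le_mn | nle_mn].
  rewrite (bigD1 (Ordinal (le_mn : (m < n.+1)%N))) //= eqxx big1 ?addr0 // => i.
  by rewrite -val_eqE /= => /negPf->; rewrite mul0r.
rewrite big1 // => i _; rewrite ifN ?mul0r //; apply: contraFneq nle_mn => <-.
by rewrite -ltnS.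
Qed.

Lemma series_mul1 f n : series_mul (series_monomial 1 0) f n = f n.
Proof. by rewrite series_mul_monomial leq0n mul1r subn0. Qed.

(** The operator z d/dz, a derivation that does not shift the degrees. *)
Definition euler f : nat -> R := fun n => f n *+ n.

Lemma euler_mul f g n :
  euler (series_mul f g) n
  = series_mul (euler f) g n + series_mul f (euler g) n.
Proof.
rewrite /euler /series_mul -sumrMnl -big_split; apply: eq_bigr => i _ /=.
by rewrite mulrnAl mulrnAr -mulrnDr subnKC // -ltnS.
Qed.

(** As g_0 = 1, the coefficient of z^(n+1) in g^2 is 2 g_(n+1) plus a
    polynomial in g_1, ..., g_n: this determines g as soon as 2 is cancellable,
    and conversely writes f in terms of g without denominators. *)
Lemma sqrt_coefE f g n : is_series_sqrt f g ->
  f n.+1 = g n.+1 *+ 2 + \sum_(i < n) g i.+1 * g (n - i)%N.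
Proof.
case=> g0 gg; rewrite -gg /series_mul big_ord_recl big_ord_recr /= g0 subn0.
by rewrite subnn g0 mul1r mulr1 addrCA mulr2n -addrA addrC -addrA.
Qed.

Lemma series_sqrt_uniq N f f' g g' : injective (fun r : R => r *+ 2) ->
    (forall i, (i <= N)%N -> f i = f' i) ->
    is_series_sqrt f g -> is_series_sqrt f' g' ->
  forall n, (n <= N)%N -> g n = g' n.
Proof.
move=> inj2 eqf sg sg'; elim/ltn_ind=> -[_ _|n IH ltnN].
  by case: sg sg' => -> _ [->].
apply: inj2; have := eqf _ ltnN; rewrite (sqrt_coefE _ sg) (sqrt_coefE _ sg').
rewrite (eq_bigr (fun i : 'I_n => g' i.+1 * g' (n - i)%N)); first exact: addIr.
move=> i _; have lt_in := ltn_ord i; congr (_ * _); apply: IH; lia.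
Qed.

Lemma series_sqrt_morph (S : comNzRingType) (phi : {rmorphism R -> S}) f g :
  is_series_sqrt f g -> is_series_sqrt (phi \o f) (phi \o g).
Proof.
case=> g0 gg; split=> [|n /=]; first by rewrite /= g0 rmorph1.
by rewrite -gg rmorph_sum; apply: eq_bigr => i _; rewrite rmorphM.
Qed.

Lemma radicand_morph (S : comNzRingType) (phi : {rmorphism R -> S}) f :
  phi \o radicand f =1 radicand (phi \o f).
Proof. by case=> [|n] /=; rewrite ?rmorph1 // rmorphM rmorphXn. Qed.

Lemma truncation_morph (S : comNzRingType) (phi : {rmorphism R -> S}) m f :
  phi \o truncation m f =1 truncation m (phi \o f).
Proof. by move=> n; rewrite /truncation /=; case: ifP; rewrite ?rmorph0. Qed.

End SeriesTheory.

(** * Partitions as sorted sequences *)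

(** Sorted sequences of naturals are used in place of the bounded sequences of
    ordinals, whose type depends on n: parts are inserted and removed below, so
    that partitions of different integers have to share a type. *)
Definition is_partition n (s : seq nat) :=
  [&& sorted geq s, all (ltn 0) s & sumn s == n].

Definition partition_list n : seq (seq nat) :=
  [seq parts pi | pi in partitions n].

Lemma part_le_sumn s i : i \in s -> (i <= sumn s)%N.
Proof. by move=> si; rewrite (perm_sumn (perm_to_rem si)) leq_addr. Qed.

Lemma size_le_sumn s : all (ltn 0) s -> (size s <= sumn s)%N.
Proof. by elim: s => //= i s IH /andP[i_gt0 /IH]; lia. Qed.

Lemma parts_inj n : injective (@parts n).
Proof. by move=> p q /(inj_map val_inj) /val_inj. Qed.

Lemma mem_partition_list n s : (s \in partition_list n) = is_partition n s.
Proof.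
apply/imageP/idP => [[pi] | s_n]; first by rewrite inE => ? ->.
have /and3P[s_sort s_gt0 /eqP s_sum] := s_n.
have s_lt i : i \in s -> (i < n.+1)%N.
  by move=> /part_le_sumn; rewrite s_sum ltnS.
have size_t : (size [seq inord i : 'I_n.+1 | i <- s] <= n)%N.
  by rewrite size_map -s_sum size_le_sumn.
have sE : parts (Bseq size_t) = s.
  rewrite /parts /= -map_comp -[RHS]map_id; apply/eq_in_map => i /s_lt i_lt.
  by rewrite /= inordK.
by exists (Bseq size_t); rewrite ?inE ?sE.
Qed.

Lemma partition_list_uniq n : uniq (partition_list n).
Proof. by rewrite map_inj_uniq ?enum_uniq //; apply: parts_inj. Qed.

Lemma partition_list0 : partition_list 0 = [:: [::]].
Proof.
apply: perm_small_eq => //; apply: uniq_perm => // [|s].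
  exact: partition_list_uniq.
rewrite mem_partition_list inE; case: s => //= i s.
by apply/negP => /and3P[_ /= /andP[i_gt0 _] ]; rewrite addn_eq0; case: i i_gt0.
Qed.

Lemma partition_card n (P : pred (seq nat)) :
  #|[set pi in partitions n | P (parts pi)]| = count P (partition_list n).
Proof.
rewrite -size_filter filter_map size_map cardE; apply/perm_size/uniq_perm.
- exact: enum_uniq.
- by rewrite filter_uniq ?enum_uniq.
by move=> pi; rewrite mem_enum inE [RHS]mem_filter mem_enum andbC.
Qed.

Lemma card_partitions n : #|partitions n| = size (partition_list n).
Proof. by rewrite size_image. Qed.

Lemma partition_parts_le n s i : is_partition n s -> i \in s -> (0 < i <= n)%N.
Proof.
case/and3P=> _ /allP s_gt0 /eqP<- si; apply/andP.
by split; [apply: s_gt0 | apply: part_le_sumn].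
Qed.

Lemma partition_sub_iota n s : is_partition n s -> {subset s <= iota 1 n}.
Proof. by move=> s_n i /(partition_parts_le s_n); rewrite mem_iota add1n. Qed.

Lemma geq_trans : transitive geq.
Proof. by move=> i j k /= ij jk; apply: leq_trans jk ij. Qed.

Lemma geq_anti : antisymmetric geq.
Proof. by move=> i j /=; rewrite andbC => /anti_leq. Qed.

Lemma geq_total : total geq.
Proof. by move=> i j; apply: leq_total. Qed.

Lemma partition_inj n n' s t :
  is_partition n s -> is_partition n' t -> perm_eq s t -> s = t.
Proof.
by move=> /and3P[? _ _] /and3P[? _ _]; apply: (sorted_eq geq_trans geq_anti).
Qed.

(** The bijection behind z d/dz of the binomial series: its inverse removes one
    occurrence of the part i. *)
Lemma perm_insert_part n i : (0 < i <= n)%N ->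
  perm_eq [seq s <- partition_list n | i \in s]
          [seq sort geq (i :: t) | t <- partition_list (n - i)].
Proof.
case/andP=> i_gt0 le_in; apply: uniq_perm.
- by rewrite filter_uniq ?partition_list_uniq.
- rewrite map_inj_in_uniq ?partition_list_uniq // => s t.
  rewrite !mem_partition_list => s_p t_p eq_st.
  apply: (partition_inj s_p t_p); rewrite -(perm_cons i).
  by rewrite -(perm_sort geq) eq_st perm_sort.
move=> s; rewrite mem_filter mem_partition_list; apply/andP/mapP.
  case=> si s_p; exists (rem i s).
    have /and3P[s_sort s_gt0 /eqP s_sum] := s_p.
    rewrite mem_partition_list; apply/and3P; split.
    - exact: (subseq_sorted geq_trans (rem_subseq _ _)).
    - by apply/allP=> j /mem_rem; apply/allP.
    - by rewrite -s_sum (perm_sumn (perm_to_rem si)) /= addKn.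
  apply: (sorted_eq geq_trans geq_anti); first by case/and3P: s_p.
    exact: (sort_sorted geq_total).
  by rewrite perm_sym perm_sort perm_sym perm_to_rem.
case=> t; rewrite mem_partition_list => /and3P[_ t_gt0 /eqP t_sum] ->.
rewrite mem_sort mem_head; split=> //; apply/and3P; split.
- exact: (sort_sorted geq_total).
- by rewrite all_sort /= i_gt0.
- by rewrite (perm_sumn (permEl (perm_sort _ _))) /= t_sum subnKC.
Qed.

Lemma sum_count_mem N s : {subset s <= iota 1 N} ->
  (\sum_(i <- iota 1 N) count_mem i s = size s)%N.
Proof.
elim: s => [|j s IH] sN; first by rewrite big1.
rewrite big_split /= IH => [|i si]; last by rewrite sN // inE si orbT.
rewrite (bigD1_seq j) ?iota_uniq ?sN ?mem_head //= eqxx big1 //= => i.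
by rewrite eq_sym => /negPf->.
Qed.

Lemma sumn_count_mem N s : (sumn s <= N)%N ->
  (\sum_(i < N) i.+1 * count_mem i.+1 s = sumn s)%N.
Proof.
elim: s => [|j s IH] /= sN; first by rewrite big1 // => i _; rewrite muln0.
under eq_bigr do rewrite mulnDr.
rewrite big_split /= IH ?(leq_trans (leq_addl _ _) sN) //; congr (_ + _)%N.
case: j sN => [|j] jN; first by rewrite big1 // => i _; rewrite muln0.
have ltjN : (j < N)%N by apply: leq_trans jN; rewrite leq_addr.
rewrite (bigD1 (Ordinal ltjN)) //= eqxx muln1 big1 ?addn0 // => i.
by rewrite -val_eqE eqSS eq_sym /= => /negPf->; rewrite muln0.
Qed.

Definition mult_fact (s : seq nat) : nat :=
  (\prod_(i <- undup s) (count_mem i s)`!)%N.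

Lemma mult_factE N s : {subset s <= iota 1 N} ->
  (\prod_(i <- iota 1 N) (count_mem i s)`! = mult_fact s)%N.
Proof.
move=> sN; rewrite (bigID (mem s)) /= [X in (_ * X)%N]big1 ?muln1 => [|i];
  last first.
  by move/count_memPn->.
rewrite -big_filter; apply/perm_big/uniq_perm; rewrite ?undup_uniq //.
  by rewrite filter_uniq ?iota_uniq.
move=> i; rewrite mem_filter mem_undup /=; case: (boolP (i \in s)) => //=.
exact: sN.
Qed.

Lemma perm_mult_fact s t : perm_eq s t -> mult_fact s = mult_fact t.
Proof.
move=> st; rewrite /mult_fact (perm_big _ (perm_undup (perm_mem st))).
by apply: eq_bigr => i _; rewrite (permP st).
Qed.

Lemma mult_fact_cons i s :
  mult_fact (i :: s) = (count_mem i (i :: s) * mult_fact s)%N.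
Proof.
rewrite /mult_fact /= eqxx add1n; case: ifP => [si | s'i].
  rewrite (bigD1_seq i) ?undup_uniq ?mem_undup //= eqxx add1n factS.
  rewrite [in RHS](bigD1_seq i) ?undup_uniq ?mem_undup //= -!mulnA.
  by do 2!congr (_ * _)%N; apply: eq_bigr => j; rewrite eq_sym => /negPf->.
rewrite big_cons eqxx add1n (count_memPn (negbT s'i)); congr (_ * _)%N.
apply: eq_big_seq => j; rewrite mem_undup => sj; case: eqP => // ij.
by rewrite ij sj in s'i.
Qed.

Lemma mult_fact_gt0 s : (0 < mult_fact s)%N.
Proof. by apply: prodn_gt0 => i; apply: fact_gt0. Qed.

(** * The binomial series *)

Lemma char0_natr_eq0 (F : fieldType) (charF : [pchar F] =i pred0) n :
  (n%:R == 0 :> F) = (n == 0%N).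
Proof. by move/pcharf0P: charF. Qed.

(** The generalized multinomial coefficient at the multiplicities of the parts,
    free of the bound up to which multiplicities are listed. *)
Definition binom_coef (F : fieldType) (a : F) (s : seq nat) : F :=
  (\prod_(j < size s) (a - j%:R)) / (mult_fact s)%:R.

Lemma gen_multinomialE (F : fieldType) (a : F) N s : {subset s <= iota 1 N} ->
  gen_multinomial a [seq count_mem i s | i <- iota 1 N] = binom_coef a s.
Proof.
move=> sN; rewrite /gen_multinomial sumnE !big_map sum_count_mem //.
by rewrite -(natr_prod _ _ xpredT) mult_factE.
Qed.

Lemma perm_binom_coef (F : fieldType) (a : F) s t :
  perm_eq s t -> binom_coef a s = binom_coef a t.
Proof.
by move=> st; rewrite /binom_coef (perm_mult_fact st) (perm_size st).
Qed.

Section BinomialSeries.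
Variables (F : fieldType) (charF : [pchar F] =i pred0).

(** The identity p binom(a; ..., p, ...) = a binom(a - 1; ..., p - 1, ...). *)
Lemma binom_coef_cons (a : F) i s :
  (count_mem i (i :: s))%:R * binom_coef a (i :: s)
  = a * binom_coef (a - 1) s.
Proof.
rewrite /binom_coef mult_fact_cons natrM invfM big_ord_recl subr0 /=.
rewrite mulrCA -!mulrA mulVKf ?char0_natr_eq0 ?eqxx //.
congr (_ * (_ * _)); apply: eq_bigr => j _.
by rewrite /bump add1n mulrSr opprD addrA addrAC.
Qed.

Variable R : comAlgType F.
Implicit Types y : nat -> R.

Lemma mulrn_inj n : injective (fun r : R => r *+ n.+1).
Proof.
move=> r1 r2 /eqP; rewrite -!scaler_nat => /eqP /scalerI; apply.
by rewrite char0_natr_eq0.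
Qed.

(** The power y^a of a series y with constant term 1. *)
Definition binom_series (a : F) y n : R :=
  \sum_(s <- partition_list n) binom_coef a s *: \prod_(i <- s) y i.

Lemma eq_binom_series a y y' n : (forall i, (i <= n)%N -> y i = y' i) ->
  binom_series a y n = binom_series a y' n.
Proof.
move=> eq_y; apply: eq_big_seq => s; rewrite mem_partition_list => s_n.
congr (_ *: _); apply: eq_big_seq => i si.
by apply: eq_y; case/andP: (partition_parts_le s_n si).
Qed.

Lemma binom_series0 a y : binom_series a y 0 = 1.
Proof.
rewrite /binom_series partition_list0 big_seq1 big_nil /binom_coef.
by rewrite big_ord0 /mult_fact big_nil divr1 scale1r.
Qed.

(** The differential equation z (y^a)' = a z y' y^(a - 1). The weight n of a
    partition is the sum of i p_i over its part sizes i; in the summand for i,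
    one occurrence of i is removed from the partition. *)
Lemma euler_binom_series a y n :
  euler (binom_series a y) n
  = a *: series_mul (euler y) (binom_series (a - 1) y) n.
Proof.
rewrite /series_mul big_ord_recl /euler mulr0n mul0r add0r scaler_sumr.
rewrite /binom_series -sumrMnl.
transitivity (\sum_(s <- partition_list n) \sum_(i < n)
    (((count_mem i.+1 s)%:R * binom_coef a s) *: \prod_(j <- s) y j) *+ i.+1).
  apply: eq_big_seq => s; rewrite mem_partition_list => /and3P[_ _ /eqP s_sum].
  rewrite -{1}s_sum -(sumn_count_mem (eq_leq s_sum)) -sumrMnr.
  apply: eq_bigr => i _; rewrite mulnC mulrnA; congr (_ *+ _).
  by rewrite -scalerA scaler_nat.
rewrite exchange_big /=; apply: eq_bigr => i _; rewrite sumrMnl.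
rewrite (bigID (fun s => i.+1 \in s)) /= addrC big1 ?add0r => [|s]; last first.
  by move/count_memPn->; rewrite mul0r scale0r.
rewrite -big_filter (perm_big _ (perm_insert_part (_ : 0 < i.+1 <= n)%N)) //=.
rewrite big_map mulrnAl -scalerMnr /bump add1n; congr (_ *+ _).
rewrite mulr_sumr scaler_sumr; apply: eq_bigr => t _.
have perm_t := permEl (perm_sort geq (i.+1 :: t)).
rewrite (perm_big _ perm_t) big_cons (permP perm_t) (perm_binom_coef _ perm_t).
by rewrite binom_coef_cons -scalerAr scalerA.
Qed.

(** Both sides have constant term 1, so it suffices to compare their images
    under z d/dz, which are both (a + b) z y' y^(a + b - 1): as z y' has no
    constant term, only lower degrees of the products y^(a - 1) y^b and
    y^(b - 1) y^a occur there, and induction on the degree applies. *)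
Lemma binom_seriesD a b y n :
  series_mul (binom_series a y) (binom_series b y) n
  = binom_series (a + b) y n.
Proof.
elim/ltn_ind: n a b => -[_|n IH] a b.
  by rewrite series_mul0 !binom_series0 mul1r.
apply: (@mulrn_inj n); rewrite -/(euler (series_mul _ _) _) euler_mul.
rewrite -/(euler (binom_series (a + b) y) _) euler_binom_series.
have step c d : c + d = a + b - 1 ->
    series_mul (series_mul (euler y) (binom_series c y)) (binom_series d y) n.+1
    = series_mul (euler y) (binom_series (a + b - 1) y) n.+1.
  move=> eq_cd; rewrite -series_mulA /series_mul.
  rewrite big_ord_recl [in RHS]big_ord_recl /euler mulr0n !mul0r;
    congr (_ + _); apply: eq_bigr => i _.
  by congr (_ * _); rewrite -eq_cd; apply: IH;
    rewrite lift0 subSS ltnS leq_subr.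
have eq_a : a - 1 + b = a + b - 1 by rewrite addrAC.
have eq_b : b - 1 + a = a + b - 1 by rewrite addrAC (addrC b).
rewrite scalerDl -{1}(step _ _ eq_a) -(step _ _ eq_b) [X in _ + X]series_mulC.
rewrite ![in RHS]/(series_mul _ _ n.+1) !scaler_sumr.
by congr (_ + _); apply: eq_bigr => i _; rewrite euler_binom_series -scalerAl.
Qed.

Lemma binom_series_0 y n : binom_series 0 y n = series_monomial 1 0 n.
Proof.
case: n => [|n]; first by rewrite binom_series0.
apply: (@mulrn_inj n); rewrite -/(euler _ n.+1) euler_binom_series scale0r.
by rewrite mul0rn.
Qed.

Lemma binom_series_1 y n : y 0%N = 1 -> binom_series 1 y n = y n.
Proof.
move=> y0; case: n => [|n]; first by rewrite binom_series0 y0.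
apply: (@mulrn_inj n); rewrite -/(euler _ n.+1) euler_binom_series scale1r.
rewrite series_mulC -[RHS]/(euler y n.+1) -[RHS]series_mul1.
by apply: eq_series_mul => // i _; rewrite subrr binom_series_0.
Qed.

Definition sqrt_series := binom_series 2%:R^-1.
Definition invsqrt_series := binom_series (- 2%:R^-1).

Let nz2 : 2%:R != 0 :> F. Proof. by rewrite char0_natr_eq0. Qed.
Let halfD : 2%:R^-1 + 2%:R^-1 = 1 :> F.
Proof. by rewrite -mulr2n -[LHS]mulr_natl divff. Qed.
Let halfB : 2%:R^-1 - 1 = - 2%:R^-1 :> F.
Proof. by rewrite -[X in _ - X]halfD opprD addrA subrr sub0r. Qed.

Lemma sqrt_seriesP y : y 0%N = 1 -> is_series_sqrt y (sqrt_series y).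
Proof.
move=> y0; split=> [|n]; first exact: binom_series0.
by rewrite binom_seriesD halfD binom_series_1.
Qed.

Lemma sqrt_invsqrt y n :
  series_mul (sqrt_series y) (invsqrt_series y) n = series_monomial 1 0 n.
Proof. by rewrite binom_seriesD subrr binom_series_0. Qed.

Lemma mul_invsqrt y n : y 0%N = 1 ->
  series_mul y (invsqrt_series y) n = sqrt_series y n.
Proof.
move=> y0; rewrite -[RHS](_ : binom_series (1 - 2%:R^-1) y n = _); last first.
  by rewrite -[X in X - _]halfD addrK.
by rewrite -binom_seriesD; apply: eq_series_mul => // i _;
  rewrite binom_series_1.
Qed.

Lemma euler_sqrt y n :
  euler (sqrt_series y) n *+ 2 = series_mul (euler y) (invsqrt_series y) n.
Proof.
by rewrite euler_binom_series halfB -scaler_nat scalerA divff // scale1r.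
Qed.

(** The differential equation 2 y w' + y' w = 0 of w = y^(-1/2). *)
Lemma invsqrt_ode y n : y 0%N = 1 ->
  series_mul y (euler (invsqrt_series y)) n *+ 2
  + series_mul (euler y) (invsqrt_series y) n = 0.
Proof.
move=> y0; set w := invsqrt_series y.
set c := binom_series (- 2%:R^-1 - 1) y.
have swap : series_mul y (series_mul (euler y) c) n = series_mul (euler y) w n.
  rewrite series_mulA (_ : _ n = series_mul (series_mul (euler y) y) c n).
    rewrite -series_mulA; apply: eq_series_mul => // i _.
    rewrite -[RHS](_ : binom_series (1 + (- 2%:R^-1 - 1)) y i = _).
      by rewrite -binom_seriesD; apply: eq_series_mul => // j _;
        rewrite binom_series_1.
    by rewrite addrC subrK.
  by apply: eq_series_mul => // i _; apply: series_mulC.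
rewrite -swap {1}/series_mul -sumrMnl -big_split big1 //= => i _.
rewrite euler_binom_series -scalerAr -scaler_nat scalerA mulrN divff //.
by rewrite scaleN1r addNr.
Qed.

End BinomialSeries.

(** * Determinants with a free first row *)

Lemma double_fact_even n :
  double_fact (2 * n) = (\prod_(i < n) (2 * (n - i)))%N.
Proof.
elim: n => [|n IH]; first by rewrite big_ord0.
rewrite big_ord_recl subn0 mulnS add2n [LHS]/= IH.
by congr (_ * _)%N; apply: eq_bigr => i _; rewrite lift0 subSS.
Qed.

Section TopRow.
Variables (R : Type) (n p : nat) (v : 'rV[R]_p) (A : 'M[R]_(n, p)).
Let M : 'M_(n.+1, p) := col_mx v A.

Lemma top_rowE j : M ord0 j = v 0 j.
Proof. by rewrite -(col_mxEu v A); congr (M _ j); apply/val_inj. Qed.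

Lemma top_row_lift i j : M (lift ord0 i) j = A i j.
Proof. by rewrite -(col_mxEd v A); congr (M _ j); apply/val_inj. Qed.
End TopRow.

Lemma cofactor_det_top (R : comNzRingType) n (v : 'rV[R]_n.+1) (x : nat -> R) :
  cofactor (col_mx v (A_mx n x) : 'M_n.+1) ord0 ord_max
  = (-1) ^+ n * (double_fact (2 * n))%:R * x 0%N ^+ n.
Proof.
rewrite /cofactor add0n -mulrA; congr (_ * _); rewrite -det_tr det_trig.
  rewrite double_fact_even natr_prod -[X in _ ^+ X]card_ord -prodr_const.
  rewrite -big_split; apply: eq_bigr => i _; do 3!rewrite mxE.
  by rewrite top_row_lift mxE lift_max leqnn subnn subn0.
apply/is_trig_mxP => i j lt_ij; do 3!rewrite mxE.
by rewrite top_row_lift mxE lift_max leqNgt lt_ij.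
Qed.

(** Let w be y^(-1/2), where y is the radicand. The column c of the elements
    x_0^j w_(n-j) is in the kernel of A: row i of A maps it to x_0^(i+1) times
      the coefficient
    of z^(n-i) in 2 y z w' + z y' w = 0. Under A with the row v on top, c is
    therefore sent to a multiple v c of the first unit vector, and multiplying
    by the adjugate gives det * c = (v c) * (first column of the adjugate). The
    last entries of both sides give the determinant, because the last cofactor
    of the first row is that of a triangular matrix. *)
Lemma det_topE (R : idomainType) n (x w : nat -> R) (v : 'rV[R]_n.+1) :
    x 0%N != 0 -> w 0%N = 1 ->
    (forall N, series_mul (radicand x) (euler w) N *+ 2
               + series_mul (euler (radicand x)) w N = 0) ->
  det_top v (A_mx n x)
  = (-1) ^+ n * (double_fact (2 * n))%:R
    * \sum_(j < n.+1) v 0 j * (x 0%N ^+ j * w (n - j)%N).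
Proof.
move=> x0_neq0 w0 ode; set M : 'M_n.+1 := col_mx v (A_mx n x).
set s := \sum_(j < _) _; pose c := \col_(j < n.+1) (x 0%N ^+ j * w (n - j)%N).
have Ac : A_mx n x *m c = 0.
  apply/colP=> i; rewrite !mxE.
  transitivity (x 0%N ^+ i.+1 * (series_mul (radicand x) (euler w) (n - i) *+ 2
      + series_mul (euler (radicand x)) w (n - i))); last by rewrite ode mulr0.
  rewrite /series_mul -sumrMnl -big_split mulr_sumr /=.
  rewrite -(big_mkord xpredT (fun d => x 0%N ^+ i.+1 *
    (radicand x d * euler w (n - i - d)%N *+ 2
     + euler (radicand x) d * w (n - i - d)%N))).
  under eq_bigr do rewrite !mxE.
  rewrite -(big_mkord xpredT (fun j => (if (i <= j)%N then
     (2 * (n - i) - (j - i))%:R * x (j - i)%N else 0)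
     * (x 0%N ^+ j * w (n - j)%N))).
  (* Columns j < i of row i vanish; the others are reindexed by d = j - i. *)
  rewrite (big_cat_nat (n := i)) //=; last by rewrite ltnW // ltnS ltnW.
  rewrite big_nat_cond big1 ?add0r => [|j]; last first.
    by rewrite andbT => /andP[_ lt_ji]; rewrite leqNgt lt_ji mul0r.
  rewrite -[X in \big[_/_]_(X <= _ < _) _]add0n big_addn -subSn ?(ltnW (ltn_ord
    i)) //.
  apply: eq_big_nat => d /andP[_]; rewrite leq_addl addnK => lt_d.
  have -> : (n - i - d)%N = (n - (d + i))%N by lia.
  have -> : (2 * (n - i) - d = 2 * (n - (d + i)) + d)%N by lia.
  rewrite /euler -(mulr_natr (w _)) natrD natrM exprD exprS.
  case: d {lt_d} => [|d] /=; first by rewrite mulr0n; ring.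
  by rewrite -(mulr_natr _ d.+1) exprS; ring.
have Mc : M *m c = col_mx (s%:M : 'M_1) 0.
  rewrite [LHS](mul_col_mx v (A_mx n x) c) Ac; suff -> : v *m c = s%:M by [].
  by apply/rowP=> i; rewrite !ord1 !mxE; apply: eq_bigr => j _; rewrite !mxE.
have := congr1 (fun B => (B *m c) ord_max 0) (mul_adj_mx M).
rewrite -mulmxA Mc mul_scalar_mx [in RHS]mxE [in RHS]mxE subnn w0 mulr1.
rewrite mxE big_ord_recl big1 ?addr0 => [|i _]; last first.
  by rewrite top_row_lift [X in _ * X]mxE mulr0.
rewrite top_rowE [X in X * _]mxE cofactor_det_top mxE eqxx mulr1n mulrAC =>
  /mulIf -> //.
by rewrite expf_neq0.
Qed.

(** The cofactors of the first row do not involve it: a determinant whose first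
    row lies in an extension ring reduces to determinants over the ring of A. *)
Lemma det_top_map (R S : comNzRingType) (phi : {rmorphism R -> S}) n
    (v : 'rV[S]_n.+1) (A : 'M[R]_(n, n.+1)) :
  det_top v (map_mx phi A)
  = \sum_j v 0 j * phi (det_top (delta_mx 0 j) A).
Proof.
rewrite /det_top (expand_det_row _ ord0); apply: eq_bigr => j _.
rewrite top_rowE; congr (_ * _); rewrite (expand_det_row _ ord0) (bigD1 j) //=.
rewrite top_rowE mxE !eqxx mul1r big1 ?addr0 => [|l /negPf ne_lj]; last first.
  by rewrite top_rowE mxE eqxx ne_lj mul0r.
rewrite /cofactor rmorphM rmorphXn rmorphN1 -det_map_mx; congr (_ * \det _).
apply/matrixP=> i l; do 2!rewrite [LHS]mxE; rewrite top_row_lift mxE.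
by do 3!rewrite [in RHS]mxE; rewrite top_row_lift.
Qed.

(** * The difference of the two square roots *)

Lemma partition_le_head n s i :
  is_partition n s -> i \in s -> (i <= head 0%N s)%N.
Proof.
case/and3P=> + _ _; case: s => //= j s; rewrite (path_sortedE geq_trans).
by case/andP=> /allP s_le _; rewrite inE => /predU1P[-> // | /s_le].
Qed.

Lemma head_mem (s : seq nat) m : (m < head 0%N s)%N -> head 0%N s \in s.
Proof. by case: s => //= j s _; rewrite mem_head. Qed.

Lemma partition_size_le m k s :
  is_partition (m + k) s -> (m < head 0%N s)%N -> (size s <= k)%N.
Proof.
case/and3P=> _; case: s => //= i s /andP[_ /size_le_sumn] + /eqP; lia.
Qed.

Section SqrtDifference.
Variables (F : fieldType) (charF : [pchar F] =i pred0) (R : comAlgType F).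
Implicit Types x : nat -> R.

(** The partition formula, at elements x_0, x_1, ... of any commutative algebra:
    it is needed both for infinitely many variables, where the family P is
    characterized, and for the variables of a single P m k. *)
Definition sqrt_diff m k x : R :=
  \sum_(s <- partition_list (m + k) | (m < head 0%N s)%N)
    binom_coef (2%:R^-1 : F) s *: (x 0%N ^+ (k - size s) * \prod_(i <- s) x i).

Lemma prod_radicand x s : all (ltn 0) s ->
  \prod_(i <- s) radicand x i
  = x 0%N ^+ (sumn s - size s) * \prod_(i <- s) x i.
Proof.
elim: s => [|i s IH] /=; first by rewrite !big_nil mulr1.
case: i => // i s_gt0; have size_s := size_le_sumn s_gt0.
rewrite !big_cons IH // addSn subSS -addnBA // exprD /=; ring.
Qed.

(** The partitions whose parts are all at most m contribute equally to both
    square roots, the others only to the first one. For a partition s of m + k,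
    the powers of x_0 in the product of the y_i add up to m + k - size s. *)
Lemma sqrt_diffE m k x :
  x 0%N ^+ m * sqrt_diff m k x
  = sqrt_series (radicand x) (m + k)
    - sqrt_series (truncation m (radicand x)) (m + k).
Proof.
rewrite /sqrt_series /binom_series -sumrB mulr_sumr.
rewrite [RHS](bigID (fun s => m < head 0%N s)%N) /= [X in _ + X]big1_seq ?addr0.
  rewrite big_seq_cond [RHS]big_seq_cond; apply: eq_bigr => s.
  rewrite mem_partition_list => /andP[s_n lt_ms].
  rewrite [X in _ - _ *: X](big_rem _ (head_mem lt_ms)) /=.
  rewrite /truncation leqNgt lt_ms mul0r scaler0 subr0 -scalerAr mulrA -exprD.
  have size_s := partition_size_le s_n lt_ms;
    case/and3P: s_n => _ s_gt0 /eqP sE.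
  by rewrite prod_radicand // sE addnBA.
move=> s; rewrite mem_partition_list -leqNgt => /andP[s_le s_n].
rewrite (eq_big_seq (truncation m (radicand x))) ?subrr // => i si.
by rewrite /truncation (leq_trans (partition_le_head s_n si)).
Qed.

Section Differential.
Variables (x : nat -> R) (m : nat).
Let y := radicand x.
Let u := sqrt_series y.
Let v := sqrt_series (truncation m y).
Let w := invsqrt_series y.

Let y0 : y 0%N = 1. Proof. by []. Qed.
Let ym0 : truncation m y 0%N = 1. Proof. by []. Qed.

(** With d = u - v, one has y - v^2 = 2 u d - d^2, where d^2 = O(z^(2m+2)) as d
    starts in degree m + 1. Dividing by u is multiplying by w. *)
Lemma sqrt_diff_small n : (n <= m.*2.+1)%N ->
  (u n - v n) *+ 2
  = series_mul (fun i => if (m < i)%N then y i else 0) w n.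
Proof.
move=> le_nm; pose d i := u i - v i.
have d_small i : (i <= m)%N -> d i = 0.
  move=> le_im; apply/eqP; rewrite subr_eq0;
    apply/eqP/eq_binom_series => j le_ji.
  by rewrite /truncation (leq_trans le_ji).
transitivity (series_mul (series_mul u w) d n *+ 2).
  rewrite -[u n - v n](series_mul1 d); congr (_ *+ _);
    apply: eq_series_mul => // i _.
  by rewrite sqrt_invsqrt.
rewrite series_mulC series_mulA -sumrMnl; apply: eq_bigr => -[j /= le_jn] _.
rewrite -mulrnAl; congr (_ * _).
transitivity (y j - truncation m y j); last first.
  by rewrite /truncation ltnNge; case: (j <= m)%N; rewrite ?subrr ?subr0.
have [_ <-] := sqrt_seriesP charF y0; have [_ <-] := sqrt_seriesP charF ym0.
rewrite mulr2n {2}series_mulC -big_split -sumrB;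
  apply: eq_bigr => -[i /= le_ij] _.
have : d i * d (j - i)%N = 0.
  have [/d_small->|lt_mi] := leqP i m; first by rewrite mul0r.
  by rewrite [d (j - i)%N]d_small ?mulr0 //; lia.
rewrite /d -/u -/v => dd0; apply/eqP; rewrite -subr_eq0 -dd0; apply/eqP.
ring.
Qed.

Variable D : {additive R -> R}.
Hypothesis DM : forall r r', D (r * r') = D r * r' + r * D r'.

(** The Leibniz rule for U^2 = f, divided by U. *)
Lemma derivation_sqrt n (f : nat -> R) : f 0%N = 1 ->
  D (sqrt_series f n) *+ 2
  = series_mul (fun i => D (f i)) (invsqrt_series f) n.
Proof.
move=> f0; set U := sqrt_series f.
transitivity (series_mul (series_mul U (invsqrt_series f)) (fun i => D (U i)) n
  *+ 2).
  rewrite -[D _](series_mul1 (fun i => D (U i))); congr (_ *+ _).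
  by apply: eq_series_mul => // i _; rewrite sqrt_invsqrt.
rewrite series_mulC series_mulA -sumrMnl; apply: eq_bigr => i _.
rewrite -mulrnAl; congr (_ * _); have [_ <-] := sqrt_seriesP charF f0.
rewrite mulr2n {2}series_mulC -big_split raddf_sum.
by apply: eq_bigr => j _ /=; rewrite DM mulrC.
Qed.
End Differential.
End SqrtDifference.

Lemma sqrt_diff_morph (F : fieldType) (R S : comAlgType F)
    (phi : {rmorphism R -> S}) m k (x : nat -> R) (x' : nat -> S) :
    (forall c r, phi (c *: r) = c *: phi r) ->
    (forall i, (i <= m + k)%N -> phi (x i) = x' i) ->
  phi (sqrt_diff m k x) = sqrt_diff m k x'.
Proof.
move=> phiZ phix; rewrite rmorph_sum big_seq_cond [RHS]big_seq_cond.
apply: eq_bigr => s; rewrite mem_partition_list => /andP[s_n _].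
rewrite phiZ rmorphM rmorphXn phix // rmorph_prod; congr (_ *: (_ * _)).
apply: eq_big_seq => i si; apply: phix.
by case/andP: (partition_parts_le s_n si).
Qed.

(** * From infinitely many variables to finitely many *)

Lemma prod_count_mem (R : comNzRingType) (f : nat -> R) N s :
  {subset s <= iota 1 N} ->
  \prod_(i <- s) f i = \prod_(i <- iota 1 N) f i ^+ count_mem i s.
Proof.
elim: s => [|j s IH] sN; first by rewrite big_nil big1.
under [RHS]eq_bigr do rewrite /= exprD.
rewrite big_cons big_split /= IH => [|i si]; last by rewrite sN // inE si orbT.
rewrite [X in _ = X * _](bigD1_seq j) ?iota_uniq ?sN ?mem_head //= eqxx.
rewrite [X in _ * X * _]big1 ?mulr1 // => i.
by rewrite eq_sym => /negPf->.
Qed.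

Lemma mpoly_endo_id (R : comNzRingType) n
    (phi : {rmorphism {mpoly R[n]} -> {mpoly R[n]}}) :
    (forall c p, phi (c *: p) = c *: phi p) -> (forall i, phi 'X_i = 'X_i) ->
  phi =1 id.
Proof.
move=> phiZ phiX p; rewrite [in LHS](mpolyE p) rmorph_sum [RHS]mpolyE.
apply: eq_bigr => m _; rewrite phiZ mpolyXE_id rmorph_prod; congr (_ *: _).
by apply: eq_bigr => i _; rewrite rmorphXn phiX.
Qed.

Section Evaluation.
Variables (F : fieldType) (N : nat).
Local Notation M := {mpoly F[N.+1]}.

(** The image of the variable of index i under the evaluation of polynomials in
    infinitely many variables at x_0, ..., x_N, 1, 1, ... *)
Definition xvar (i : nat) : M := if (i <= N)%N then x_ i else 1.

Definition eval_monomial (m : monalg.cmonom nat) : M :=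
  \prod_(i < N.+1) 'X_i ^+ m i.

Lemma eval_monomial_morph : monalg.mmorphism eval_monomial.
Proof.
split=> [m m'|].
  by rewrite /eval_monomial -big_split; apply: eq_bigr => i _;
    rewrite monalg.mulcmE exprD.
by rewrite /eval_monomial big1 // => i _; rewrite monalg.onecmE.
Qed.

Definition eval_mmorphism : monalg.MMorphism.type (monalg.cmonom nat) M :=
  monalg.MMorphism.Pack (monalg.MMorphism.Class
    (monalg.isMultiplicative.Build _ _ _ eval_monomial_morph)).

Definition eval_infpoly : {rmorphism infpoly F -> M} :=
  monalg.mmap (@mpolyC N.+1 F) eval_mmorphism.

Lemma eval_infvar i : eval_infpoly (infvar F i) = xvar i.
Proof.
rewrite [LHS]monalg.mmapU /= mpolyC1 mul1r /eval_monomial /xvar.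
case: ifP => [le_iN | nle_iN].
  rewrite (bigD1 (inord i)) //= monalg.ucmE inordK // eqxx expr1 big1 ?mulr1 //
    => j.
  rewrite -val_eqE /= inordK // => /negPf ne_ji.
  by rewrite monalg.ucmE eq_sym ne_ji.
rewrite big1 // => j _; rewrite monalg.ucmE; case: eqP => // eq_ij.
by rewrite eq_ij -ltnS ltn_ord in nle_iN.
Qed.

Definition embed_morph : {rmorphism M -> infpoly F} :=
  mmap (in_alg (infpoly F)) (fun i : 'I_N.+1 => infvar F i).

Lemma embedZ c (p : M) : embed_morph (c *: p) = c *: embed_morph p.
Proof. by rewrite /= mmapZ /= mulr_algl. Qed.

Lemma embed_x i : (i <= N)%N -> embed_morph (x_ i) = infvar F i.
Proof. by move=> le_iN; rewrite /= mmapX mmap1U inordK. Qed.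

Lemma eval_infpolyZ c p : eval_infpoly (c *: p) = c *: eval_infpoly p.
Proof. by rewrite [LHS]monalg.mmapZ mul_mpolyC. Qed.

Lemma embedK p : eval_infpoly (embed p) = p.
Proof.
apply: (mpoly_endo_id (phi := eval_infpoly \o embed_morph)) => [c q | i].
  by rewrite [LHS](congr1 eval_infpoly (embedZ c q)) eval_infpolyZ.
have le_iN : (i <= N)%N by rewrite -ltnS.
have -> : 'X_i = x_ i :> M by rewrite /x_ inord_val.
by rewrite [LHS](congr1 eval_infpoly (embed_x le_iN)) eval_infvar /xvar le_iN.
Qed.

Lemma xvar0_neq0 : xvar 0 != 0.
Proof. by rewrite /xvar leq0n -msupp_eq0 msuppX. Qed.

End Evaluation.

(** * Existence and uniqueness of the family *)

Section Family.
Variables (F : fieldType) (charF : [pchar F] =i pred0).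

Definition sqrt_poly m k : {mpoly F[(m + k).+1]} :=
  sqrt_diff m k (@xvar F (m + k)).

Lemma embed_sqrt_poly m k : embed (sqrt_poly m k) = sqrt_diff m k (infvar F).
Proof.
apply: (@sqrt_diff_morph _ _ _ (embed_morph F (m + k))); first exact: embedZ.
by move=> i le_i; rewrite /xvar le_i embed_x.
Qed.

Lemma sqrt_poly_family : is_sqrt_family sqrt_poly.
Proof.
move=> m; exists (sqrt_series (radicand (infvar F))).
exists (sqrt_series (truncation m (radicand (infvar F)))); split.
- exact: sqrt_seriesP.
- exact: sqrt_seriesP.
move=> n; rewrite series_mul_monomial; case: ifP => [/subnKC nE | /negbT].
  rewrite -[in RHS]nE.
  rewrite -sqrt_diffE; congr (_ * _); case: (n - m)%N => [|k];
    last by rewrite embed_sqrt_poly.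
  rewrite /sqrt_diff big1_seq // => s /=; rewrite mem_partition_list addn0.
  case/andP=> lt_ms /partition_parts_le /(_ (head_mem lt_ms)).
  by case/andP=> _; rewrite leqNgt lt_ms.
rewrite -ltnNge => lt_nm;
  rewrite [X in _ - X](_ : _ = sqrt_series (radicand (infvar F)) n).
  by rewrite subrr.
apply: eq_binom_series => i le_in.
by rewrite /truncation ltnW // (leq_ltn_trans le_in).
Qed.

(** Evaluation turns the defining identity into one between polynomials in
    x_0, ..., x_(m+k), an integral domain in which the square roots are unique
    and x_0^m can be cancelled. *)
Lemma sqrt_familyE P : is_sqrt_family P ->
  forall m k, (0 < k)%N -> P m k = sqrt_poly m k.
Proof.
move=> P_family m k k_gt0; have [u [v [u_sqrt v_sqrt]]] := P_family m.
move/(_ (m + k)%N); rewrite series_mul_monomial leq_addr addKn.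
pose ev := @eval_infpoly F (m + k); set X := @xvar F (m + k).
have evX : ev \o infvar F =1 X by move=> i; apply: eval_infvar.
have ev_rad i : (ev \o radicand (infvar F)) i = radicand X i.
  by rewrite (radicand_morph ev); case: i => //= i; rewrite -!evX.
have inj2 : injective (fun p : {mpoly F[(m + k).+1]} => p *+ 2) by apply:
  mulrn_inj.
have evu : ev (u (m + k)%N) = sqrt_series (radicand X) (m + k).
  apply: (series_sqrt_uniq inj2 _ (series_sqrt_morph ev u_sqrt)) (leqnn _).
    by move=> i _; apply: ev_rad.
  exact: sqrt_seriesP.
have evv : ev (v (m + k)%N) = sqrt_series (truncation m (radicand X)) (m + k).
  apply: (series_sqrt_uniq inj2 _ (series_sqrt_morph ev v_sqrt)) (leqnn _).
    by move=> i _; rewrite truncation_morph /truncation ev_rad.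
  exact: sqrt_seriesP.
(* The identity is a match on the index, which reduces for a successor. *)
case: k k_gt0 @ev @X evX ev_rad inj2 evu evv => // k _ ev X evX _ _ evu evv.
move/(congr1 ev); rewrite rmorphM rmorphXn rmorphB /= -/ev embedK evu evv.
rewrite -sqrt_diffE (evX 0%N : ev (infvar F 0) = X 0%N).
exact: (mulfI (expf_neq0 m (xvar0_neq0 F (m + k.+1)))).
Qed.

Lemma expansion_termE m k (pi : (m + k).-bseq 'I_(m + k).+1) :
  pi \in partitions (m + k) ->
  expansion_term F pi
  = binom_coef 2%:R^-1 (parts pi)
    *: (@xvar F (m + k) 0 ^+ (k - size (parts pi))
        * \prod_(i <- parts pi) @xvar F (m + k) i).
Proof.
rewrite inE => /partition_sub_iota parts_in.
rewrite /expansion_term /multiplicity -(gen_multinomialE _ parts_in).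
rewrite size_map {1}/xvar leq0n; congr (_ *: (_ * _)).
rewrite (prod_count_mem _ parts_in) /index_iota subSS subn0.
apply: eq_big_seq => i; rewrite mem_iota add1n ltnS /xvar.
by case/andP=> _ ->.
Qed.

Lemma sqrt_polyE m k :
  sqrt_poly m k
  = \sum_(pi in partitions (m + k) | (m < largest_part pi)%N)
      expansion_term F pi.
Proof.
rewrite [LHS]big_map big_enum_cond /=.
by apply: eq_bigr => pi /andP[/expansion_termE ->].
Qed.
End Family.

(** * Determinantal formulas *)

Section Determinants.
Variables (F : fieldType) (charF : [pchar F] =i pred0) (m n : nat).
Local Notation M := {mpoly F[(m + n.+1).+1]}.
Local Notation X := (@xvar F (m + n.+1)).
Local Notation w := (invsqrt_series (radicand X)).

Lemma xvarE i : (i <= m + n.+1)%N -> X i = x_ i.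
Proof. by rewrite /xvar => ->. Qed.

Lemma sqrt_poly_small : (n <= m)%N ->
  sqrt_poly F m n.+1 *+ 2
  = \sum_(j < n.+1) x_ (m + j.+1) * (X 0%N ^+ j * w (n - j)%N).
Proof.
move=> le_nm; apply: (mulfI (expf_neq0 m (xvar0_neq0 F (m + n.+1)))).
rewrite mulrnAr sqrt_diffE sqrt_diff_small //; last by lia.
rewrite /series_mul -(big_mkord xpredT (fun i =>
  (if (m < i)%N then radicand X i else 0) * w (m + n.+1 - i)%N)).
rewrite (big_cat_nat (n := m.+1)) //=;
  last by rewrite -addnS addnS ltnS leq_addr.
rewrite big_nat_cond big1 ?add0r => [|i]; last first.
  by case/andP=> /andP[_ lt_im] _; rewrite ltnNge -ltnS lt_im mul0r.
rewrite -[m.+1]add0n big_addn (_ : (m + n.+1).+1 - m.+1 = n.+1)%N; last by lia.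
rewrite big_mkord mulr_sumr; apply: eq_bigr => j _.
have lt_jn := ltn_ord j; rewrite -xvarE; last by lia.
have [-> ->] : (j + m.+1 = (m + j).+1 /\ m + j.+1 = (m + j).+1)%N by lia.
rewrite ltnS leq_addr (_ : m + n.+1 - (m + j).+1 = n - j)%N; last by lia.
by rewrite /= exprD; ring.
Qed.

(** The truncated square root does not involve x_(m+1+j), and the derivative of
    the radicand y with respect to x_(m+1+j) is x_0^(m+j) z^(m+j+1). *)
Lemma sqrt_poly_deriv (j : 'I_n.+1) :
  (sqrt_poly F m n.+1)^`M(inord (m + j.+1)) *+ 2 = X 0%N ^+ j * w (n - j)%N.
Proof.
apply: (mulfI (expf_neq0 m (xvar0_neq0 F (m + n.+1)))).
set i0 : 'I_(m + n.+1).+1 := inord _; have lt_jn := ltn_ord j.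
have i0E : i0 = (m + j.+1)%N :> nat by rewrite inordK //; lia.
pose D : {additive M -> M} := mderiv i0.
have DM p q : D (p * q) = D p * q + p * D q by apply: mderivM.
have DX i : D (X i) = (i == (m + j.+1)%N)%:R.
  rewrite /D /= /xvar; case: ifP => [le_i | gt_i].
    rewrite mderivX mnm1E -val_eqE /= inordK // i0E; case: eqP => [->|_].
      by rewrite -/i0 -{1}[U_(i0)%MM]add0m addmK mpolyX0 scale1r.
    by rewrite scale0r.
  rewrite -mpolyC1 mderivC; case: eqP => // ei; rewrite ei in gt_i.
  by move/negP: gt_i; case; lia.
have DX0 i : D (X 0%N ^+ i) = 0.
  elim: i => [|i IH]; first by rewrite expr0 /D /= -mpolyC1 mderivC.
  by rewrite exprS DM IH DX ltn_eqF ?mul0r ?mulr0 ?addr0 //; lia.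
have Drad i : D (radicand X i) = series_monomial (X 0%N ^+ (m + j)%N) (m +
  j.+1)%N i.
  have jE : (m + j.+1 = (m + j).+1)%N := addnS m j.
  rewrite /series_monomial jE; case: i => [|i].
    by rewrite /radicand /D /= -mpolyC1 mderivC.
  rewrite /radicand DM DX0 mulr0 addr0 DX jE eqSS; case: eqP => [->|_].
    by rewrite mul1r.
  by rewrite mul0r.
transitivity (D (X 0%N ^+ m * sqrt_poly F m n.+1) *+ 2).
  by rewrite DM DX0 mul0r add0r mulrnAr.
rewrite sqrt_diffE raddfB mulrnBl !(derivation_sqrt charF DM) //.
have -> : series_mul (fun i => D (truncation m (radicand X) i))
            (invsqrt_series (truncation m (radicand X))) (m + n.+1) = 0.
  rewrite /series_mul big1 // => i _; rewrite /truncation;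
    case: ifP => [le_im|_].
    rewrite Drad /series_monomial ifN ?mul0r // neq_ltn; apply/orP; left; lia.
  by rewrite raddf0 mul0r.
rewrite subr0 (eq_series_mul (f' := series_monomial (X 0%N ^+ (m + j)%N) (m +
  j.+1)%N) (g' := w)) //.
rewrite series_mul_monomial (_ : m + j.+1 <= m + n.+1)%N; last by lia.
by rewrite (_ : m + n.+1 - (m + j.+1) = n - j)%N 1?exprD ?mulrA //; lia.
Qed.

(** Each term contains a variable of index larger than m. *)
Lemma sqrt_poly_at_origin c : at_origin (c *: sqrt_poly F m n.+1) = 0.
Proof.
rewrite /at_origin comp_mpolyZ.
rewrite (sqrt_diff_morph (phi := comp_mpoly _ : {rmorphism M -> M})
    (x' := fun i => if (i <= m)%N then X i else 0)).
- rewrite /sqrt_diff big1_seq ?scaler0 // => s /andP[lt_ms _].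
  by rewrite (big_rem _ (head_mem lt_ms)) /= leqNgt lt_ms mul0r mulr0 scaler0.
- by move=> *; apply: comp_mpolyZ.
move=> i le_i; rewrite xvarE // [LHS]comp_mpolyXU -tnth_nth tnth_mktuple.
by rewrite inordK.
Qed.

Lemma det_top_sum v : det_top v (A_mx n (@x_ F (m + n.+1)))
  = ((-1) ^+ n * (double_fact (2 * n))%:R)
    *: \sum_(j < n.+1) v 0 j * (X 0%N ^+ j * w (n - j)%N).
Proof.
rewrite (_ : A_mx n x_ = A_mx n X); last first.
  apply/matrixP=> i j; rewrite !mxE; case: ifP => // _.
  by rewrite xvarE //; have := ltn_ord j; lia.
rewrite (det_topE (w := w)) ?xvar0_neq0 //; last 2 first.
- exact: binom_series0.
- by move=> N; apply: invsqrt_ode.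
rewrite -[RHS]mulr_algl; congr (_ * _).
by rewrite -[RHS]/(in_alg M _) rmorphM rmorphXn rmorphN1 rmorph_nat.
Qed.

Lemma dx_formE : dx_form F m n
  = \sum_(j < n.+1) (((-1) ^+ n * (double_fact (2 * n))%:R : F)
                     *: (X 0%N ^+ j * w (n - j)%N)) *: 'X_j.
Proof.
rewrite /dx_form (det_top_map (@mpolyC n.+1 M)); apply: eq_bigr => j _.
rewrite mxE mulrC mul_mpolyC det_top_sum; congr (_ *: _ *: _).
rewrite (bigD1 j) //= mxE !eqxx mul1r big1 ?addr0 // => i /negPf ne_ij.
by rewrite mxE eqxx ne_ij mul0r.
Qed.
End Determinants.

Lemma double_fact_gt0 n : (0 < double_fact n)%N.
Proof. by elim/ltn_ind: n => -[|[|n]] //= IH; rewrite muln_gt0 IH. Qed.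

Lemma double_factS n :
  double_fact (2 * n.+1) = (2 * n.+1 * double_fact (2 * n))%N.
Proof. by rewrite mulnS. Qed.

Lemma signr_div (F : fieldType) n (d e : F) : (-1) ^+ n / d * ((-1) ^+ n * e) =
  e / d.
Proof. by rewrite mulrACA -expr2 sqrr_sign mul1r mulrC. Qed.

Section Clauses.
Variables (F : fieldType) (charF : [pchar F] =i pred0).
Local Notation P := (sqrt_poly F).

Let dfF n : (double_fact n)%:R != 0 :> F.
Proof. by rewrite (char0_natr_eq0 charF) -lt0n double_fact_gt0. Qed.
Let F2 : 2%:R != 0 :> F. Proof. by rewrite (char0_natr_eq0 charF). Qed.

Lemma scale_natK (R : comAlgType F) (p q : R) d :
  (0 < d)%N -> p *+ d = q -> p = d%:R^-1 *: q.
Proof.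
move=> d_gt0 <-; rewrite -scaler_nat scalerA mulVf ?scale1r //.
by rewrite (char0_natr_eq0 charF) -lt0n.
Qed.

Lemma sqrt_poly_line_integral m n :
  let c : F := (-1) ^+ n * (double_fact (2 * n) * 2)%:R in
  is_line_integral (dx_form F m n) (c *: P m n.+1).
Proof.
move=> c; split; last exact: sqrt_poly_at_origin.
rewrite (dx_formE charF); apply: eq_bigr => j _; congr (_ *: _).
rewrite linearZ /= -(sqrt_poly_deriv charF) -scaler_nat scalerA; congr (_ *: _).
by rewrite -mulrA -natrM.
Qed.

Lemma sqrt_poly_integral m n : let k := n.+1 in
  exists I : {mpoly F[(m + k).+1]},
    is_line_integral (dx_form F m n) I /\
    P m k = ((-1) ^+ (k - 1) / (double_fact (2 * k - 2) * 2)%:R) *: I.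
Proof.
move=> k; rewrite /k subn1 /= (_ : 2 * n.+1 - 2 = 2 * n)%N; last by lia.
eexists; split; first exact: sqrt_poly_line_integral.
by rewrite scalerA signr_div divff ?scale1r // natrM mulf_neq0.
Qed.

Lemma sqrt_poly_det_small m n : let k := n.+1 in (k - 1 <= m)%N ->
  P m k = ((-1) ^+ (k - 1) / (double_fact (2 * k - 2) * 2)%:R)
          *: det_top (\row_j x_ (m + j.+1)) (A_mx n x_).
Proof.
move=> k; rewrite /k subn1 /= (_ : 2 * n.+1 - 2 = 2 * n)%N; last by lia.
move=> le_nm; rewrite det_top_sum // scalerA signr_div natrM invfM mulrA divff
  //.
rewrite mul1r; apply: scale_natK => //; rewrite sqrt_poly_small //.
by apply: eq_bigr => j _; rewrite mxE.
Qed.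

Lemma sqrt_series_truncation0 (R : comAlgType F) (y : nat -> R) n :
  sqrt_series (truncation 0 y) n.+1 = 0.
Proof.
apply: (mulrn_inj charF (n := n)); apply: (mulrn_inj charF (n := 1)).
rewrite -/(euler _ n.+1) (euler_sqrt charF) !mul0rn /series_mul big1 // => i _.
rewrite /euler /truncation; case: (i : nat) => [|j];
  first by rewrite mulr0n mul0r.
by rewrite mul0rn mul0r.
Qed.

Lemma sqrt_diff0E (R : comAlgType F) (x : nat -> R) k :
  (0 < k)%N -> sqrt_diff 0 k x = sqrt_series (radicand x) k.
Proof.
case: k => // n _; rewrite -[LHS]mul1r -[1](expr0 (x 0%N)) sqrt_diffE add0n.
by rewrite sqrt_series_truncation0 subr0.
Qed.

(** The coefficient of z^(n+1) in 2 z u' = z y' w. *)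
Lemma sqrt_poly0_euler n :
  P 0 n.+1 *+ (2 * n.+1)
  = \sum_(j < n.+1) j.+1%:R * x_ j.+1
      * (xvar F n.+1 0 ^+ j
         * invsqrt_series (radicand (xvar F n.+1)) (n - j)%N).
Proof.
rewrite [sqrt_poly F 0 n.+1]sqrt_diff0E // mulnC mulrnA (euler_sqrt charF).
rewrite /series_mul big_ord_recl /euler mulr0n mul0r add0r;
  apply: eq_bigr => j _.
rewrite lift0 /= -[x_ j.+1](@xvarE F 0 n) // subSS -mulr_natr; ring.
Qed.

Lemma sqrt_poly0_det n : let k := n.+1 in
  P 0%N k = ((-1) ^+ (k - 1) / (double_fact (2 * k))%:R)
            *: det_top (\row_j (j.+1%:R * x_ j.+1)) (A_mx n x_).
Proof.
move=> k; rewrite /k subn1 succnK [X in _ = _ *: X](det_top_sum charF) scalerA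
  signr_div.
rewrite double_factS natrM invfM mulrCA divff // mulr1.
apply: scale_natK => //; rewrite sqrt_poly0_euler.
by apply: eq_bigr => j _; rewrite mxE.
Qed.

(** With all variables equal to 1, the radicand y is 1/(1-z). The equations
    u = y w and 2 z u' = z y' w give 2 (i+1) u_(i+1) - 2 i u_i = u_i, since the
    coefficients of z y' increase by one from each degree to the next. *)
Lemma sqrt_geometric (n : nat) : let one := fun _ => 1 : F^o in
  sqrt_series one n = (double_fact (2 * n - 1))%:R / (double_fact (2 * n))%:R.
Proof.
move=> one; set u := sqrt_series one; set w := invsqrt_series one.
have uE i : u i = \sum_(j < i.+1) w (i - j)%N.
  rewrite -[u i](mul_invsqrt charF) //.
  by apply: eq_bigr => j _; rewrite mul1r.
have eulerE i : u i *+ i *+ 2 = \sum_(j < i.+1) w (i - j)%N *+ j.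
  rewrite -/(euler u i) (euler_sqrt charF).
  by apply: eq_bigr => j _; rewrite /euler mulrnAl mul1r.
have step i : u i.+1 *+ (2 * i.+1) = u i *+ (2 * i).+1.
  rewrite mulnC mulrnA eulerE mulrS mulnC mulrnA eulerE {1}uE -big_split.
  rewrite big_ord_recl mulr0n add0r; apply: eq_bigr => j _.
  by rewrite lift0 subSS mulrS.
elim: n => [|n IH]; first by rewrite /u /sqrt_series binom_series0 /= divr1.
have nz : (2 * n.+1)%:R != 0 :> F by rewrite (char0_natr_eq0 charF).
have odd_df : double_fact (2 * n.+1 - 1) = ((2 * n).+1 * double_fact (2 * n -
  1))%N.
  by case: n {IH step nz} => // n; rewrite !mulnS.
apply: (mulIf nz); rewrite mulr_natr step IH -[LHS]mulr_natr odd_df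
  double_factS.
rewrite (natrM _ (2 * n.+1)) (natrM _ (2 * n).+1); move: (dfF (2 * n)) nz.
move: (double_fact _)%:R (double_fact _)%:R (2 * n.+1)%:R (2 * n).+1%:R => c a
  b d.
by move=> c0 b0; rewrite invfM (mulrC b^-1) mulrA divfK // [LHS]mulrC mulrA.
Qed.

Lemma binom_series_morph (R S : comAlgType F) (phi : {rmorphism R -> S}) a y n :
    (forall c r, phi (c *: r) = c *: phi r) ->
  phi (binom_series a y n) = binom_series a (phi \o y) n.
Proof.
move=> phiZ; rewrite rmorph_sum; apply: eq_bigr => s _.
by rewrite phiZ rmorph_prod.
Qed.

Section AllOnes.
Variable N : nat.
Let ev : {rmorphism {mpoly F[N.+1]} -> F^o} := meval (fun=> 1).

Lemma evZ c p : ev (c *: p) = c *: ev p. Proof. exact: mevalZ. Qed.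

Lemma ev_xvar i : ev (xvar F N i) = 1.
Proof. by rewrite /xvar; case: ifP => _; rewrite ?rmorph1 //;
  apply: mevalXU. Qed.

Lemma ev_radicand i : ev (radicand (xvar F N) i) = 1.
Proof. by case: i => [|i] /=;
  rewrite ?rmorph1 // rmorphM rmorphXn !ev_xvar expr1n mulr1. Qed.

Lemma ev_binom_series a n :
  ev (binom_series a (radicand (xvar F N)) n)
  = binom_series a (fun=> 1 : F^o) n.
Proof.
rewrite binom_series_morph; last exact: evZ.
by apply: eq_binom_series => i _; apply: ev_radicand.
Qed.
End AllOnes.

Lemma sqrt_poly0_ones k : (0 < k)%N ->
  (P 0 k).@[fun=> 1] = (double_fact (2 * k - 1))%:R / (double_fact (2 * k))%:R.
Proof.
move=> k_gt0; rewrite /sqrt_poly sqrt_diff0E // [LHS]ev_binom_series.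
exact: sqrt_geometric.
Qed.

Lemma sqrt_poly_ones m k : (0 < k)%N -> (k - 1 <= m)%N ->
  (P m k).@[fun=> 1]
  = (double_fact (2 * k - 3))%:R / (double_fact (2 * k - 2) * 2)%:R.
Proof.
case: k => // n _; rewrite subn1 succnK => le_nm.
have [-> ->] : (2 * n.+1 - 3 = 2 * n - 1 /\ 2 * n.+1 - 2 = 2 * n)%N by lia.
rewrite natrM invfM mulrA.
apply: (mulIf F2); rewrite divfK // -sqrt_geometric mulr_natr -mevalMn.
rewrite sqrt_poly_small // -[RHS](mul_invsqrt charF) //.
pose ev : {rmorphism {mpoly F[(m + n.+1).+1]} -> F^o} := meval (fun=> 1).
rewrite -[LHS]/(ev _) rmorph_sum; apply: eq_bigr => j _.
rewrite mul1r -xvarE; last by have := ltn_ord j; lia.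
rewrite !rmorphM rmorphXn [ev (xvar _ _ 0)]ev_xvar expr1n mul1r.
by rewrite [ev (xvar _ _ _)]ev_xvar mul1r [LHS]ev_binom_series.
Qed.
End Clauses.

(** * Explicit polynomials of small degree *)

Section ClosedForms.
Variables (F : fieldType) (charF : [pchar F] =i pred0).
Local Notation P := (sqrt_poly F).

Section Coefficients.
Variables (R : comAlgType F) (y : nat -> R).
Hypothesis y0 : y 0%N = 1.
Let u := sqrt_series y.
Let w := invsqrt_series y.

(** Expressing the radicand by its root, instead of the converse, has integer
    coefficients; the closed forms below become polynomial identities in the
    coefficients of the root. *)
Lemma radicand_of_sqrt :
  (y 1 = 2 * u 1) * (y 2 = 2 * u 2 + u 1 ^+ 2)
  * (y 3 = 2 * u 3 + 2 * u 1 * u 2)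
  * (y 4 = 2 * u 4 + 2 * u 1 * u 3 + u 2 ^+ 2)
  * (y 5 = 2 * u 5 + 2 * u 1 * u 4 + 2 * u 2 * u 3)
  * (y 6 = 2 * u 6 + 2 * u 1 * u 5 + 2 * u 2 * u 4 + u 3 ^+ 2).
Proof.
by do !split; rewrite (sqrt_coefE _ (sqrt_seriesP charF y0)) -/u
  ?big_ord_recl big_ord0 /=; ring.
Qed.

Lemma sqrt_series_2 : u 2 *+ 8 = 4 * y 2 - y 1 ^+ 2.
Proof. by rewrite !radicand_of_sqrt; ring. Qed.

Lemma sqrt_series_3 : u 3 *+ 16 = 8 * y 3 - 4 * y 1 * y 2 + y 1 ^+ 3.
Proof. by rewrite !radicand_of_sqrt; ring. Qed.

Lemma sqrt_series_4 :
  u 4 *+ 128 = 64 * y 4 - 16 * (2 * y 1 * y 3 + y 2 ^+ 2)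
               + 24 * y 1 ^+ 2 * y 2 - 5 * y 1 ^+ 4.
Proof. by rewrite !radicand_of_sqrt; ring. Qed.

Lemma sqrt_series_5 :
  u 5 *+ 256 = 128 * y 5 - 64 * (y 1 * y 4 + y 2 * y 3)
               + 48 * (y 1 ^+ 2 * y 3 + y 1 * y 2 ^+ 2)
               - 40 * y 1 ^+ 3 * y 2 + 7 * y 1 ^+ 5.
Proof. by rewrite !radicand_of_sqrt; ring. Qed.

Lemma sqrt_series_6 :
  u 6 *+ 1024 = 512 * y 6 - 128 * (2 * y 1 * y 5 + 2 * y 2 * y 4 + y 3 ^+ 2)
                + 192 * y 1 ^+ 2 * y 4 + 384 * y 1 * y 2 * y 3 + 64 * y 2 ^+ 3
                - 160 * y 1 ^+ 3 * y 3 - 240 * y 1 ^+ 2 * y 2 ^+ 2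
                + 140 * y 1 ^+ 4 * y 2 - 21 * y 1 ^+ 6.
Proof. by rewrite !radicand_of_sqrt; ring. Qed.

Lemma invsqrt_of_sqrt :
  (w 0 = 1) * (w 1 = - u 1) * (w 2 = u 1 ^+ 2 - u 2)
  * (w 3 = 2 * u 1 * u 2 - u 1 ^+ 3 - u 3).
Proof.
have w0 : w 0%N = 1 by apply: binom_series0.
have rec n : w n.+1 = - \sum_(i < n.+1) u i.+1 * w (n - i)%N.
  have := sqrt_invsqrt charF y n.+1; rewrite /series_mul big_ord_recl subn0.
  rewrite {1}/sqrt_series binom_series0 mul1r => /eqP;
    rewrite addr_eq0 -/w => /eqP ->.
  by congr (- _); apply: eq_bigr => i _; rewrite lift0 subSS.
have w1 : w 1%N = - u 1 by rewrite rec big_ord1 w0 mulr1.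
have w2 : w 2%N = u 1 ^+ 2 - u 2.
  rewrite rec !big_ord_recl big_ord0 /= w0 w1; ring.
by do !split=> //; rewrite rec !big_ord_recl big_ord0 /= w0 w1 w2; ring.
Qed.

Lemma invsqrt_series_1 : w 1 *+ 2 = - y 1.
Proof. by rewrite invsqrt_of_sqrt !radicand_of_sqrt; ring. Qed.

Lemma invsqrt_series_2 : w 2 *+ 8 = 3 * y 1 ^+ 2 - 4 * y 2.
Proof. by rewrite invsqrt_of_sqrt !radicand_of_sqrt; ring. Qed.

Lemma invsqrt_series_3 : w 3 *+ 16 = 12 * y 1 * y 2 - 5 * y 1 ^+ 3 - 8 * y 3.
Proof. by rewrite invsqrt_of_sqrt !radicand_of_sqrt; ring. Qed.
End Coefficients.

Lemma scale_divK (R : comAlgType F) (p q : R) d :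
  (0 < d)%N -> p *+ d = q -> p = (1 / d%:R) *: q.
Proof. by rewrite div1r; apply: scale_natK. Qed.

Lemma sqrt_poly_m1 m : P m 1 = (1 / 2) *: x_ (m + 1).
Proof.
apply: scale_divK => //; rewrite sqrt_poly_small // big_ord1.
by rewrite mul1r invsqrt_of_sqrt mulr1.
Qed.

Lemma sqrt_poly_02 : P 0 2 = (1 / 8) *: (4 * x_ 0 * x_ 2 - x_ 1 ^+ 2).
Proof.
apply: scale_divK => //; rewrite [sqrt_poly F 0 2]sqrt_diff0E //.
by rewrite sqrt_series_2 // /= /xvar /=; ring.
Qed.

Lemma sqrt_poly_03 : P 0 3 =
  (1 / 16) *: (8 * x_ 0 ^+ 2 * x_ 3 - 4 * x_ 0 * x_ 1 * x_ 2 + x_ 1 ^+ 3).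
Proof.
apply: scale_divK => //; rewrite [sqrt_poly F 0 3]sqrt_diff0E //.
by rewrite sqrt_series_3 // /= /xvar /=; ring.
Qed.

Lemma sqrt_poly_04 : P 0 4 =
  (1 / 128) *: (64 * x_ 0 ^+ 3 * x_ 4
                - 16 * x_ 0 ^+ 2 * (2 * x_ 1 * x_ 3 + x_ 2 ^+ 2)
                + 24 * x_ 0 * x_ 1 ^+ 2 * x_ 2 - 5 * x_ 1 ^+ 4).
Proof.
apply: scale_divK => //; rewrite [sqrt_poly F 0 4]sqrt_diff0E //.
by rewrite sqrt_series_4 // /= /xvar /=; ring.
Qed.

Lemma sqrt_poly_m2 m : (1 <= m)%N ->
  P m 2 = (1 / 4) *: (2 * x_ 0 * x_ (m + 2) - x_ 1 * x_ (m + 1)).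
Proof.
move=> m_ge1; apply: scale_divK => //;
  rewrite (mulrnA _ 2 2) sqrt_poly_small //.
rewrite !big_ord_recl big_ord0 /= (invsqrt_of_sqrt _).1.1.1 //.
set w1 := invsqrt_series _ _;
  have w1E : w1 *+ 2 = - radicand (@xvar F (m + 2)) 1.
  exact: invsqrt_series_1.
transitivity (x_ (m + 1) * (w1 *+ 2) + 2 * xvar F (m + 2) 0 * x_ (m + 2));
  first by ring.
by rewrite w1E /= !xvarE; [ring | lia..].
Qed.

Lemma sqrt_poly_m3 m : (2 <= m)%N ->
  P m 3 = (1 / 16) *: (8 * x_ 0 ^+ 2 * x_ (m + 3)
                       - 4 * x_ 0 * (x_ 1 * x_ (m + 2) + x_ 2 * x_ (m + 1))
                       + 3 * x_ 1 ^+ 2 * x_ (m + 1)).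
Proof.
move=> m_ge2; apply: scale_divK => //;
  rewrite (mulrnA _ 2 8) sqrt_poly_small //.
rewrite !big_ord_recl big_ord0 /= (invsqrt_of_sqrt _).1.1.1 //.
set w1 := invsqrt_series _ 1%N; set w2 := invsqrt_series _ 2%N.
have w1E := @invsqrt_series_1 _ (radicand (xvar F (m + 3))) erefl.
have w2E := @invsqrt_series_2 _ (radicand (xvar F (m + 3))) erefl.
transitivity (x_ (m + 1) * (w2 *+ 8) + 4 * xvar F (m + 3) 0 * x_ (m + 2) * (w1
  *+ 2)
              + 8 * xvar F (m + 3) 0 ^+ 2 * x_ (m + 3)); first by ring.
by rewrite w1E w2E /= !xvarE; [ring | lia..].
Qed.

Lemma sqrt_poly_m4 m : (3 <= m)%N ->
  P m 4 = (1 / 32) *: (16 * x_ 0 ^+ 3 * x_ (m + 4)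
                       - 8 * x_ 0 ^+ 2
                         * (x_ 1 * x_ (m + 3) + x_ 2 * x_ (m + 2)
                            + x_ 3 * x_ (m + 1))
                       + 6 * x_ 0
                         * (x_ 1 ^+ 2 * x_ (m + 2) + 2 * x_ 1 * x_ 2 * x_ (m +
                           1))
                       - 5 * x_ 1 ^+ 3 * x_ (m + 1)).
Proof.
move=> m_ge3; apply: scale_divK => //;
  rewrite (mulrnA _ 2 16) sqrt_poly_small //.
rewrite !big_ord_recl big_ord0 /= (invsqrt_of_sqrt _).1.1.1 //.
set w1 := invsqrt_series _ 1%N; set w2 := invsqrt_series _ 2%N.
set w3 := invsqrt_series _ 3%N.
have w1E := @invsqrt_series_1 _ (radicand (xvar F (m + 4))) erefl.
have w2E := @invsqrt_series_2 _ (radicand (xvar F (m + 4))) erefl.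
have w3E := @invsqrt_series_3 _ (radicand (xvar F (m + 4))) erefl.
transitivity (x_ (m + 1) * (w3 *+ 16) + 2 * xvar F (m + 4) 0 * x_ (m + 2) * (w2
  *+ 8)
              + 8 * xvar F (m + 4) 0 ^+ 2 * x_ (m + 3) * (w1 *+ 2)
              + 16 * xvar F (m + 4) 0 ^+ 3 * x_ (m + 4)); first by ring.
by rewrite w1E w2E w3E /= !xvarE; [ring | lia..].
Qed.

Lemma sqrt_poly_13 : P 1 3 =
  (1 / 16) *: (8 * x_ 0 ^+ 2 * x_ 4 - 2 * x_ 0 * (2 * x_ 1 * x_ 3 + x_ 2 ^+ 2)
               + 3 * x_ 1 ^+ 2 * x_ 2).
Proof.
apply: scale_divK => //; apply: (mulfI (xvar0_neq0 F 4)).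
(* The coefficients of both square roots have the common denominator 128 = 16 *
  8. *)
apply: (@mulrn_inj _ charF _ 7).
transitivity ((xvar F 4 0 ^+ 1 * P 1 3) *+ 128); first by ring.
by rewrite sqrt_diffE mulrnBl !sqrt_series_4 // /truncation /= /xvar /=; ring.
Qed.

Lemma sqrt_poly_14 : P 1 4 =
  (1 / 32) *: (16 * x_ 0 ^+ 3 * x_ 5
               - 8 * x_ 0 ^+ 2 * (x_ 1 * x_ 4 + x_ 2 * x_ 3)
               + 6 * x_ 0 * (x_ 1 ^+ 2 * x_ 3 + x_ 1 * x_ 2 ^+ 2)
               - 5 * x_ 1 ^+ 3 * x_ 2).
Proof.
apply: scale_divK => //; apply: (mulfI (xvar0_neq0 F 5)).
(* The coefficients of both square roots have the common denominator 256 = 32 *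
  8. *)
apply: (@mulrn_inj _ charF _ 7).
transitivity ((xvar F 5 0 ^+ 1 * P 1 4) *+ 256); first by ring.
by rewrite sqrt_diffE mulrnBl !sqrt_series_5 // /truncation /= /xvar /=; ring.
Qed.

Lemma sqrt_poly_24 : P 2 4 =
  (1 / 32) *: (16 * x_ 0 ^+ 3 * x_ 6
               - 4 * x_ 0 ^+ 2 * (2 * x_ 1 * x_ 5 + 2 * x_ 2 * x_ 4 + x_ 3 ^+ 2)
               + 6 * x_ 0 * (x_ 1 ^+ 2 * x_ 4 + 2 * x_ 1 * x_ 2 * x_ 3)
               - 5 * x_ 1 ^+ 3 * x_ 3).
Proof.
apply: scale_divK => //; apply: (mulfI (expf_neq0 2 (xvar0_neq0 F 6))).
(* The coefficients of both square roots have the common denominator 1024 = 32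
  * 32. *)
apply: (@mulrn_inj _ charF _ 31).
transitivity ((xvar F 6 0 ^+ 2 * P 2 4) *+ 1024); first by ring.
by rewrite sqrt_diffE mulrnBl !sqrt_series_6 // /truncation /= /xvar /=; ring.
Qed.
End ClosedForms.

(** * Monomials and coefficients *)

Definition part_mnm k N (s : seq nat) : 'X_{1..N.+1} :=
  [multinom (if i == 0 :> nat then k - size s else count_mem (i : nat) s)%N
     | i < N.+1].

Lemma part_mnm0 k N s : part_mnm k N s ord0 = (k - size s)%N.
Proof. by rewrite mnmE. Qed.

Lemma part_mnmS k N s (i : 'I_N) : part_mnm k N s (lift ord0 i) = count_mem
  i.+1 s.
Proof. by rewrite mnmE lift0. Qed.

Lemma big_iota1 (R : Type) (idx : R) (op : R -> R -> R) (f : nat -> R) N :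
  \big[op/idx]_(i <- iota 1 N) f i = \big[op/idx]_(i < N) f i.+1.
Proof. by rewrite -[1%N]addn0 iotaDl big_map -{1}[N]subn0 big_mkord. Qed.

Section Monomials.
Variable F : fieldType.

Lemma part_mnmE k N s : is_partition N s ->
  xvar F N 0 ^+ (k - size s) * \prod_(i <- s) xvar F N i = 'X_[part_mnm k N s].
Proof.
move=> s_N; rewrite mpolyXE_id big_ord_recl part_mnm0.
rewrite (prod_count_mem _ (partition_sub_iota s_N)) big_iota1;
  congr (_ ^+ _ * _).
  by rewrite /xvar leq0n /x_; congr 'X_[U_(_)]; apply: val_inj;
    rewrite /= inordK.
apply: eq_bigr => i _; rewrite part_mnmS /xvar ltn_ord /x_; congr (_ ^+ _).
by congr 'X_[U_(_)]; apply: val_inj; rewrite /= inordK // ltnS.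
Qed.
End Monomials.

Lemma part_mnm_inj k N s t : is_partition N s -> is_partition N t ->
  part_mnm k N s = part_mnm k N t -> s = t.
Proof.
move=> s_N t_N /mnmP eq_st; apply: (partition_inj s_N t_N);
  apply/allP => i _ /=.
apply/eqP; case: (boolP (i \in iota 1 N)) => [|N'i]; last first.
  by rewrite !(count_memPn _) //; apply: contra N'i; apply: partition_sub_iota.
rewrite mem_iota add1n ltnS; case: i => // i /andP[_ lt_iN].
by have := eq_st (lift ord0 (Ordinal lt_iN)); rewrite !part_mnmS.
Qed.

Lemma mdeg_part_mnm k N s : is_partition N s -> (size s <= k)%N ->
  mdeg (part_mnm k N s) = k.
Proof.
move=> s_N le_sk; rewrite mdegE big_ord_recl part_mnm0.
under eq_bigr do rewrite part_mnmS.
rewrite -(big_iota1 _ _ (fun i => count_mem i s)) sum_count_mem ?subnK //.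
exact: partition_sub_iota.
Qed.

Lemma weight_part_mnm k N s : is_partition N s ->
  (\sum_(i < N.+1) i * part_mnm k N s i)%N = N.
Proof.
case/and3P=> _ _ /eqP sN; rewrite big_ord_recl mul0n add0n.
under eq_bigr do rewrite part_mnmS lift0.
by rewrite sumn_count_mem ?sN.
Qed.

Section Coefficients.
Variables (F : fieldType) (charF : [pchar F] =i pred0).
Local Notation P := (sqrt_poly F).

Definition admissible m k s := is_partition (m + k) s && (m < head 0%N s)%N.

Lemma sqrt_poly_mnm m k :
  P m k = \sum_(s <- [seq s <- partition_list (m + k) | (m < head 0%N s)%N])
            binom_coef 2%:R^-1 s *: 'X_[part_mnm k (m + k) s].
Proof.
rewrite big_filter [RHS]big_seq_cond [LHS]big_seq_cond; apply: eq_bigr => s.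
by rewrite mem_partition_list => /andP[/part_mnmE->].
Qed.

Lemma mem_admissible m k s :
  (s \in [seq s <- partition_list (m + k) | (m < head 0%N s)%N]) = admissible m
    k s.
Proof. by rewrite mem_filter mem_partition_list andbC. Qed.

Lemma sqrt_poly_coef m k s : admissible m k s ->
  (P m k)@_(part_mnm k (m + k) s) = binom_coef 2%:R^-1 s.
Proof.
move=> s_adm; rewrite sqrt_poly_mnm raddf_sum (bigD1_seq s) /=; first last.
- by rewrite filter_uniq ?partition_list_uniq.
- by rewrite mem_admissible.
rewrite mcoeffZ mcoeffX eqxx mulr1 big1_seq ?addr0 // => t /andP[ne_ts].
rewrite mem_admissible mcoeffZ mcoeffX => /andP[t_n _]; case: eqP => [|_].
  have [s_n _] := andP s_adm; move/(part_mnm_inj t_n s_n) => ts.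
  by rewrite ts eqxx in ne_ts.
by rewrite mulr0.
Qed.

Lemma sqrt_poly_coef0 m k e :
  (forall s, admissible m k s -> part_mnm k (m + k) s != e) -> (P m k)@_e = 0.
Proof.
move=> ne_e; rewrite sqrt_poly_mnm raddf_sum big1_seq //= => s.
by rewrite mem_admissible mcoeffZ mcoeffX => /ne_e /negPf->; rewrite mulr0.
Qed.

Lemma msupp_sqrt_poly m k e : e \in msupp (P m k) ->
  exists2 s, admissible m k s & e = part_mnm k (m + k) s.
Proof.
rewrite mcoeff_msupp => nz_e; have [/hasP[s]|/hasPn no_s] :=
  boolP (has (fun s => part_mnm k (m + k) s == e)
    [seq s <- partition_list (m + k) | (m < head 0%N s)%N]).
  by rewrite mem_admissible => s_adm /eqP<-; exists s.
case/eqP: nz_e; apply: sqrt_poly_coef0 => s s_adm; apply: no_s.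
by rewrite mem_admissible.
Qed.

Lemma sqrt_poly_homog m k : P m k \is k.-homog.
Proof.
apply/dhomogP => e /msupp_sqrt_poly[s /andP[s_n lt_ms] ->].
by apply: mdeg_part_mnm => //; apply: partition_size_le lt_ms.
Qed.

Lemma sqrt_poly_isobaric m k : isobaric (m + k) (P m k).
Proof.
by move=> e /msupp_sqrt_poly[s /andP[s_n _] ->]; apply: weight_part_mnm.
Qed.

Lemma half_falling_factorial l :
  \prod_(j < l.+1) (2%:R^-1 - j%:R)
  = (-1) ^+ l * (double_fact (2 * l - 1))%:R / (2 ^ l.+1)%:R :> F.
Proof.
have F2 : 2%:R != 0 :> F by rewrite (char0_natr_eq0 charF).
elim: l => [|l IH]; first by rewrite big_ord1 subr0 mul1r mul1r.
rewrite big_ord_recr /= IH (_ : 2 * l.+1 - 1 = (2 * l).+1)%N; last by lia.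
have -> : double_fact (2 * l).+1 = ((2 * l).+1 * double_fact (2 * l - 1))%N.
  by case: l {IH} => // l; rewrite mulnS.
rewrite !natrX !exprS natrM -[(2 * l).+1]addn1 natrD natrM -[l.+1]addn1 natrD.
by field; rewrite expf_neq0.
Qed.
End Coefficients.

Lemma fact_double l : ((2 * l)`! = 2 ^ l * l`! * double_fact (2 * l - 1))%N.
Proof.
elim: l => [|l IH] //; rewrite mulnS add2n !factS IH expnS.
have -> : double_fact ((2 * l).+2 - 1) = ((2 * l).+1 * double_fact (2 * l -
  1))%N.
  by case: l {IH} => // l; rewrite !mulnS.
by rewrite (_ : (2 * l).+2 = 2 * l.+1)%N ?mulnS //; ring.
Qed.

Lemma odd_double_fact l : odd (double_fact (2 * l - 1)).
Proof.
elim: l => [|[|l] IH] //; have -> : (2 * l.+2 - 1 = (2 * l.+1 - 1).+2)%N by lia.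
by rewrite oddM IH andbT; lia.
Qed.

(** The quotient of the two sides is a Catalan number, as the central binomial
    coefficient 'C(2 l, l) times l! equals 2^l (2 l - 1)!!. *)
Lemma fact_dvd_double_fact l : (l.+1`! %| 2 ^ l * double_fact (2 * l - 1))%N.
Proof.
have cat : (l.+1 %| 'C(2 * l, l))%N.
  rewrite -(@Gauss_dvdr _ l) ?coprimeSn //.
  have -> : (l * 'C(2 * l, l) = l.+1 * 'C(2 * l, l.+1))%N.
    by rewrite mul_bin_left; congr (_ * _)%N; lia.
  exact: dvdn_mulr.
have bin_df : ('C(2 * l, l) * l`! = 2 ^ l * double_fact (2 * l - 1))%N.
  apply/eqP; rewrite -(eqn_pmul2r (fact_gt0 l)) -mulnA.
  have := bin_fact (leq_pmull l (isT : 0 < 2)%N).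
  rewrite (_ : 2 * l - l = l)%N => [->|]; last by lia.
  by rewrite fact_double mulnAC.
by rewrite -bin_df factS dvdn_mul.
Qed.

Lemma prod_fact_dvd (I : Type) (r : seq I) (f : I -> nat) :
  (\prod_(i <- r) (f i)`! %| (\sum_(i <- r) f i)`!)%N.
Proof.
elim: r => [|i r IH]; first by rewrite !big_nil.
rewrite !big_cons; set S := (\sum_(j <- r) f j)%N in IH *.
rewrite -(bin_fact (leq_addr S (f i))) addKn.
by apply: dvdn_mull; apply: dvdn_mul.
Qed.

Lemma mult_fact_dvd n s : is_partition n s -> (mult_fact s %| (size s)`!)%N.
Proof.
move=> /partition_sub_iota s_n.
by rewrite -(mult_factE s_n) -(sum_count_mem s_n) prod_fact_dvd.
Qed.

(** Let l be the length of s. The numerator (2 l - 3)!! is odd and the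
    denominator is 2^l times mult_fact s, whose odd part divides (2 l - 3)!!
    because mult_fact s divides l!, which divides 2^(l - 1) (2 l - 3)!!. The
    witness b is the quotient; it is the same integer over every field. *)
Lemma binom_coef_half n s : is_partition n s -> (0 < n)%N ->
  exists2 b, odd b & forall F : fieldType, [pchar F] =i pred0 ->
    binom_coef (2%:R^-1 : F) s
    = (-1) ^+ (size s).-1 * b%:R / (2 ^ (size s + logn 2 (mult_fact s)))%:R.
Proof.
move=> s_n n_gt0; have size_s : (size s).-1.+1 = size s.
  apply: prednK; rewrite lt0n size_eq0; apply/eqP => s0; move: s_n.
  by rewrite s0 /is_partition /= => /eqP n0; rewrite -n0 in n_gt0.
set l := (size s).-1 in size_s *.
have [o co_2o DE] := pfactor_coprime (isT : prime 2) (mult_fact_gt0 s).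
have /dvdnP[b bE] : (o %| double_fact (2 * l - 1))%N.
  rewrite -(@Gauss_dvdr _ (2 ^ l)); last by rewrite coprimeXr // coprime_sym.
  apply: dvdn_trans (fact_dvd_double_fact l); rewrite size_s.
  by apply: dvdn_trans (mult_fact_dvd s_n); rewrite DE dvdn_mulr.
exists b => [|F charF].
  by have := odd_double_fact l; rewrite bE oddM => /andP[].
have nz d : (0 < d)%N -> d%:R != 0 :> F.
  by move=> d_gt0; rewrite (char0_natr_eq0 charF) -lt0n.
have o_gt0 : (0 < o)%N by case: o co_2o {DE bE}.
rewrite /binom_coef -size_s (half_falling_factorial charF) bE [in LHS]DE.
rewrite expnD !natrM; field.
by rewrite !nz // expn_gt0.
Qed.

(** Legendre's formula at the prime 2. The digits are the differences
    k / 2^i - 2 (k / 2^(i+1)) of integer quotients, and their sum telescopes. *)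
Lemma binary_digit_sum_logn k : (binary_digit_sum k + logn 2 k`! = k)%N.
Proof.
rewrite logn_fact // big_add1 big_mkord /=.
have := divn_small (ltn_expl k (isT : 1 < 2)%N) => top.
have step i : (k %/ 2 ^ i = 2 * (k %/ 2 ^ i.+1) + (k %/ 2 ^ i) %% 2)%N.
  by rewrite expnSr divnMA mulnC -divn_eq.
have : (\sum_(i < k) k %/ 2 ^ i
        = 2 * (\sum_(i < k) k %/ 2 ^ i.+1) + binary_digit_sum k)%N.
  by rewrite big_distrr -big_split; apply: eq_bigr => i _; apply: step.
have : (\sum_(i < k.+1) k %/ 2 ^ i = \sum_(i < k) k %/ 2 ^ i)%N.
  by rewrite big_ord_recr /= top addn0.
have : (\sum_(i < k.+1) k %/ 2 ^ i = k + \sum_(i < k) k %/ 2 ^ i.+1)%N.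
  by rewrite big_ord_recl expn0 divn1.
move: (\sum_(i < k.+1) _)%N (\sum_(i < k) k %/ 2 ^ i)%N => A B {step top}.
move: (\sum_(i < k) _)%N (binary_digit_sum k) => S b; lia.
Qed.

(** * Denominators *)

Lemma ratr_div (F : fieldType) (charF : [pchar F] =i pred0) (a : int) d :
  (0 < d)%N -> ratr (a%:~R / d%:R) = a%:~R / d%:R :> F.
Proof.
move=> d_gt0; set x : rat := _ / _.
have d_neq0 (K : fieldType) : [pchar K] =i pred0 -> d%:R != 0 :> K.
  by move=> charK; rewrite (char0_natr_eq0 charK) -lt0n.
have den_neq0 : (denq x)%:~R != 0 :> F.
  rewrite -(gez0_abs (denq_ge0 x)) (char0_natr_eq0 charF) absz_eq0.
  exact: denq_neq0.
have num_den : numq x * d%:Z = a * denq x.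
  apply: (@intr_inj rat); rewrite !rmorphM /= numqE mulrAC divfK //.
  exact/d_neq0/Num.Theory.pchar_num.
apply/eqP; rewrite /ratr eqr_div ?d_neq0 //.
by rewrite -[d%:R]/(d%:Z%:~R) -!rmorphM num_den.
Qed.

Lemma absz_denq (a : int) e : odd `|a| ->
  `|denq (a%:~R / (2 ^ e)%:R)|%N = (2 ^ e)%N.
Proof.
move=> odd_a; rewrite -[(2 ^ e)%:R]/((2 ^ e)%N%:Z%:~R) coprimeq_den /=.
  by case: eqP => // /eqP; rewrite eqz_nat expn_eq0.
by rewrite coprimeXr // coprimen2.
Qed.

Lemma biglcm_eq (T : eqType) (r : seq T) (f : T -> nat) L :
    (forall x, x \in r -> f x %| L)%N -> (exists2 x, x \in r & f x = L) ->
  \big[lcmn/1%N]_(x <- r) f x = L.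
Proof.
move=> f_dvd [x rx fx]; apply/eqP; rewrite eqn_dvd; apply/andP; split.
  rewrite big_seq; apply: (big_ind (fun d => d %| L)%N) => //.
  by move=> d e dL eL; rewrite dvdn_lcm dL.
by rewrite -fx (big_rem x) //= dvdn_lcml.
Qed.

Definition denom_exponent (s : seq nat) := (size s + logn 2 (mult_fact s))%N.

Definition max_exponent m k := (k + logn 2 (if m == 0 then k else k.-1)`!)%N.

Lemma max_exponentE m k : (0 < k)%N ->
  (2 ^ max_exponent m k)%N
  = if m == 0%N then (2 ^ (2 * k - binary_digit_sum k))%N
    else (2 ^ (2 * k - binary_digit_sum (k - 1) - 1))%N.
Proof.
move=> k_gt0; rewrite /max_exponent -(subn1 k); case: ifP => _; congr (2 ^ _)%N.
  by have := binary_digit_sum_logn k; lia.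
by have := binary_digit_sum_logn (k - 1); lia.
Qed.

Lemma logn_fact_le p a b : (a <= b)%N -> (logn p a`! <= logn p b`!)%N.
Proof. by move=> le_ab;
  rewrite dvdn_leq_log ?fact_gt0 // -(bin_fact le_ab) mulnCA dvdn_mulr. Qed.

(** A partition s of m + k with a part larger than m has length at most k, and
    mult_fact s divides (size s)!. If m > 0 and the length is k, the largest
    part occurs only once, since otherwise the parts would add up to more than
      m + k;
    it contributes the factor 1! to mult_fact s, which thus divides (k - 1)!. *)
Lemma denom_exponent_le m k s : admissible m k s ->
  (denom_exponent s <= max_exponent m k)%N.
Proof.
case/andP=> s_n lt_ms; have le_sk := partition_size_le s_n lt_ms.
have mult_le n : (size s <= n)%N -> (logn 2 (mult_fact s) <= logn 2 n`!)%N.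
  move=> le_sn; apply: leq_trans (logn_fact_le _ le_sn).
  by rewrite dvdn_leq_log ?fact_gt0 // (mult_fact_dvd s_n).
rewrite /max_exponent; case: eqP => [_|/eqP m_neq0];
  first by rewrite leq_add ?mult_le.
move: le_sk; rewrite leq_eqVlt => /predU1P[size_s | lt_sk]; last first.
  by apply: leq_add; [apply: ltnW | apply: mult_le; lia].
rewrite /denom_exponent size_s leq_add2l.
case: s s_n lt_ms mult_le size_s => // h t s_n /= lt_mh _ size_t.
have /and3P[_ /= /andP[h_gt0 t_gt0] /eqP s_sum] := s_n.
have h't : h \notin t.
  apply/negP => ht; have := size_le_sumn (_ : all (ltn 0%N) (rem h t)).
  rewrite size_rem // => /(_ _); have := perm_sumn (perm_to_rem ht).
  move=> /= t_sum; move: s_sum size_t; rewrite t_sum.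
  have : all (ltn 0%N) (rem h t) by apply/allP => i /mem_rem; apply/allP.
  by move=> t'_gt0 s_sum size_t /(_ t'_gt0); lia.
have tE : mult_fact (h :: t) = mult_fact t.
  by rewrite mult_fact_cons /= eqxx (count_memPn h't) mul1n.
have t_n : is_partition (sumn t) t.
  rewrite /is_partition t_gt0 eqxx !andbT.
  by case/and3P: s_n => /= /path_sorted.
rewrite tE -size_t dvdn_leq_log ?fact_gt0 //.
exact: mult_fact_dvd t_n.
Qed.

(** The partition at which the bound on the exponent is attained. For m = 0 its
    first part is one of k parts 1. *)
Definition extremal_partition m k := m.+1 :: nseq k.-1 1%N.

Lemma mult_fact_nseq n : mult_fact (nseq n 1%N) = n`!.
Proof.
elim: n => [|n IH]; first by rewrite /mult_fact big_nil.
by rewrite mult_fact_cons IH /= count_nseq /= mul1n factS.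
Qed.

Lemma extremal_partitionP m k : (0 < k)%N -> admissible m k (extremal_partition
  m k).
Proof.
case: k => // k _; rewrite /admissible /= ltnSn andbT /is_partition /=.
have path_ones i : path geq i.+1 (nseq k 1%N).
  by elim: k i => //= k IH i; rewrite IH.
by rewrite path_ones sumn_nseq mul1n addSnnS eqxx all_nseq orbT.
Qed.

Lemma denom_exponent_extremal m k : (0 < k)%N ->
  denom_exponent (extremal_partition m k) = max_exponent m k.
Proof.
case: k => // k _; rewrite /denom_exponent /max_exponent /= size_nseq.
congr (_ + logn 2 _)%N; rewrite mult_fact_cons mult_fact_nseq /=.
by rewrite eqxx count_nseq /= eqSS eq_sym; case: (m == 0%N); rewrite ?mul1n.
Qed.

Lemma binom_coef_half_neq0 (F : fieldType) (charF : [pchar F] =i pred0) n s :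
  is_partition n s -> (0 < n)%N -> binom_coef (2%:R^-1 : F) s != 0.
Proof.
move=> s_n n_gt0; have [b odd_b ->] // := binom_coef_half s_n n_gt0.
rewrite mulf_neq0 ?mulf_neq0 ?signr_eq0 ?invr_eq0 ?(char0_natr_eq0 charF) //.
  by apply: contraTneq odd_b => ->.
by rewrite expn_eq0.
Qed.

(** The same formula over the field of rationals provides the preimages of the
    coefficients under ratr. *)
Lemma sqrt_poly_lcm (F : fieldType) (charF : [pchar F] =i pred0) m k :
  (0 < k)%N ->
  is_lcm_denominators (sqrt_poly F m k) (2 ^ max_exponent m k).
Proof.
move=> k_gt0; pose Q := sqrt_poly rat m k.
have charQ : [pchar rat] =i pred0 := Num.Theory.pchar_num _.
have mk_gt0 : (0 < m + k)%N by rewrite addn_gt0 k_gt0 orbT.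
have den s : admissible m k s ->
    ratr (binom_coef 2%:R^-1 s) = binom_coef 2%:R^-1 s :> F
    /\ `|denq (binom_coef 2%:R^-1 s)|%N = (2 ^ denom_exponent s)%N.
  case/andP=> s_n _; have [b odd_b bE] := binom_coef_half s_n mk_gt0.
  have zE (K : fieldType) : (-1) ^+ (size s).-1 * b%:R = ((-1) ^+ (size s).-1 *
    b%:Z)%:~R :> K.
    by rewrite rmorphM rmorphXn rmorphN1.
  rewrite !bE // !zE ratr_div ?expn_gt0 // absz_denq //.
  by rewrite abszMsign.
exists (fun e => Q@_e); split=> [e|].
  have [/hasP[s]|/hasPn no_s] := boolP (has (fun s => part_mnm k (m + k) s == e)
    [seq s <- partition_list (m + k) | (m < head 0%N s)%N]).
    rewrite mem_admissible => s_adm /eqP<-; rewrite !sqrt_poly_coef //.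
    by case: (den s s_adm).
  have no_s' s : admissible m k s -> part_mnm k (m + k) s != e.
    by rewrite -mem_admissible => /no_s.
  by rewrite !sqrt_poly_coef0 //; apply/esym/(ratr_nat F 0).
apply/esym/biglcm_eq => [e /msupp_sqrt_poly[s s_adm ->] | ].
  by rewrite sqrt_poly_coef // (den s s_adm).2 dvdn_exp2l ?denom_exponent_le.
have ext := extremal_partitionP m k_gt0.
exists (part_mnm k (m + k) (extremal_partition m k)); last first.
  by rewrite sqrt_poly_coef // (den _ ext).2 denom_exponent_extremal.
case/andP: (ext) => ext_n _; rewrite mcoeff_msupp sqrt_poly_coef //.
exact: (binom_coef_half_neq0 charF ext_n).
Qed.

(** * Counting the terms *)

(** Removing the first part leaves a partition of some i < k. Conversely, for
    k <= m + 1 the new part m + k - i is larger than m and hence than all parts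
    of a partition of i, so that it can be put in front. *)
Lemma perm_large_first_part m k : (k.-1 <= m)%N ->
  perm_eq [seq s <- partition_list (m + k) | (m < head 0%N s)%N]
          [seq (m + k - i)%N :: t | i <- iota 0 k, t <- partition_list i].
Proof.
move=> le_km; apply: uniq_perm.
- by rewrite filter_uniq ?partition_list_uniq.
- apply: allpairs_uniq_dep => [|i _|[i s] [j t]];
  rewrite ?iota_uniq ?partition_list_uniq //.
  case/allpairsPdep=> i' [s' [_ + [-> ->]]] /allpairsPdep[j' [t' [_ + [->
    ->]]]].
  rewrite !mem_partition_list => /and3P[_ _ /eqP s_sum] /and3P[_ _ /eqP t_sum]
    [_ st].
  by rewrite -s_sum -t_sum st.
move=> s; rewrite mem_admissible; apply/idP/allpairsPdep.
  case: s => [|h t]; rewrite /admissible /= ?andbF // => /andP[s_n lt_mh].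
  have /and3P[/= /path_sorted t_sort /andP[_ t_gt0] /eqP s_sum] := s_n.
  exists (sumn t), t; rewrite mem_iota mem_partition_list /is_partition.
  by rewrite t_sort t_gt0 eqxx; split=> //; [lia | congr (_ :: _); lia].
case=> i [t [+ + ->]];
  rewrite mem_iota mem_partition_list add0n => /= lt_ik t_i.
have /and3P[t_sort t_gt0 /eqP t_sum] := t_i.
rewrite /admissible /is_partition /= t_gt0 t_sum (path_sortedE geq_trans)
  t_sort !andbT.
apply/andP; split; last by lia.
apply/and3P; split; [|lia|apply/eqP; lia].
by apply/allP => j /(partition_parts_le t_i) /=; lia.
Qed.

Section Counting.
Variables (F : fieldType) (charF : [pchar F] =i pred0).

Lemma expansion_term_neq0 m k (pi : (m + k).-bseq 'I_(m + k).+1) :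
  (0 < k)%N -> pi \in partitions (m + k) -> expansion_term F pi != 0.
Proof.
move=> k_gt0 pi_p; rewrite expansion_termE //; move: pi_p; rewrite inE => pi_p.
rewrite (part_mnmE _ _ pi_p) scaler_eq0 negb_or (binom_coef_half_neq0 charF
  pi_p).
  by rewrite -msupp_eq0 msuppX.
by rewrite addn_gt0 k_gt0 orbT.
Qed.

Lemma card_nonzero_terms m k : (0 < k)%N ->
  #|[set pi in partitions (m + k) |
       (m < largest_part pi)%N && (expansion_term F pi != 0)]|
  = size [seq s <- partition_list (m + k) | (m < head 0%N s)%N].
Proof.
move=> k_gt0; rewrite size_filter -partition_card; apply: eq_card => pi.
rewrite [LHS]inE [RHS]inE; case: (boolP (pi \in partitions _)) => //= pi_p.
by rewrite expansion_term_neq0 ?andbT.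
Qed.

Lemma card_terms0 k : (0 < k)%N ->
  #|[set pi in partitions (0 + k) |
       (0 < largest_part pi)%N && (expansion_term F pi != 0)]|
  = #|partitions k|.
Proof.
move=> k_gt0; rewrite card_nonzero_terms // card_partitions; congr size.
apply/all_filterP/allP => s; rewrite mem_partition_list => s_k.
have /and3P[_ s_gt0 /eqP s_sum] := s_k.
case: s s_gt0 s_sum {s_k} => [_ /= s_sum|i s /andP[]] //.
by move: k_gt0; rewrite -[k]add0n -s_sum.
Qed.

Lemma card_terms m k : (0 < k)%N -> (k - 1 <= m)%N ->
  #|[set pi in partitions (m + k) |
       (m < largest_part pi)%N && (expansion_term F pi != 0)]|
  = (\sum_(i < k) #|partitions i|)%N.
Proof.
move=> k_gt0; rewrite subn1 => le_km; rewrite card_nonzero_terms //.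
rewrite (perm_size (perm_large_first_part le_km)) size_allpairs_dep sumnE
  big_map.
rewrite -(subn0 k) -/(index_iota 0 k) big_mkord subn0.
by apply: eq_bigr => i _; rewrite card_partitions.
Qed.
End Counting.

(** * The theorem *)

(* An integer k >= 1 is written k = n.+1 wherever the matrix A is involved. *)
Theorem theorem3 (F : fieldType) (charF : [pchar F] =i pred0) :
  (exists P : forall m k : nat, {mpoly F[(m + k).+1]}, is_sqrt_family P) /\
  forall P : forall m k : nat, {mpoly F[(m + k).+1]}, is_sqrt_family P ->
  (* (1) *)
  (forall m k : nat, (0 < k)%N ->
     P m k \is k.-homog /\ isobaric (m + k) (P m k)) /\
  (* (2) *)
  (forall m k : nat, (0 < k)%N ->
     P m k = \sum_(pi in partitions (m + k) | (m < largest_part pi)%N)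
               expansion_term F pi) /\
  (* (3) *)
  (forall m k : nat, (0 < k)%N ->
     is_lcm_denominators (P m k)
       (if m == 0%N then 2 ^ (2 * k - binary_digit_sum k)
        else 2 ^ (2 * k - binary_digit_sum (k - 1) - 1))%N) /\
  (* (4) *)
  (forall m n : nat, let k := n.+1 in
     exists I : {mpoly F[(m + k).+1]},
       is_line_integral (dx_form F m n) I /\
       P m k = ((-1) ^+ (k - 1) / (double_fact (2 * k - 2) * 2)%:R) *: I) /\
  (* (5) *)
  (forall n : nat, let k := n.+1 in
     P 0%N k = ((-1) ^+ (k - 1) / (double_fact (2 * k))%:R)
               *: det_top (\row_j (j.+1%:R * x_ j.+1)) (A_mx n x_)) /\
  (* (6) *)
  (forall m n : nat, let k := n.+1 in (k - 1 <= m)%N ->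
     P m k = ((-1) ^+ (k - 1) / (double_fact (2 * k - 2) * 2)%:R)
             *: det_top (\row_j x_ (m + j.+1)) (A_mx n x_)) /\
  (* (7) *)
  ((forall m : nat, P m 1%N = (1 / 2) *: x_ (m + 1)) /\
   P 0%N 2%N = (1 / 8) *: (4 * x_ 0 * x_ 2 - x_ 1 ^+ 2) /\
   (forall m : nat, (1 <= m)%N ->
      P m 2%N = (1 / 4) *: (2 * x_ 0 * x_ (m + 2) - x_ 1 * x_ (m + 1))) /\
   P 0%N 3%N =
     (1 / 16) *: (8 * x_ 0 ^+ 2 * x_ 3 - 4 * x_ 0 * x_ 1 * x_ 2 + x_ 1 ^+ 3) /\
   P 1%N 3%N =
     (1 / 16) *: (8 * x_ 0 ^+ 2 * x_ 4
                  - 2 * x_ 0 * (2 * x_ 1 * x_ 3 + x_ 2 ^+ 2)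
                  + 3 * x_ 1 ^+ 2 * x_ 2) /\
   (forall m : nat, (2 <= m)%N ->
      P m 3%N =
        (1 / 16) *: (8 * x_ 0 ^+ 2 * x_ (m + 3)
                     - 4 * x_ 0 * (x_ 1 * x_ (m + 2) + x_ 2 * x_ (m + 1))
                     + 3 * x_ 1 ^+ 2 * x_ (m + 1))) /\
   P 0%N 4%N =
     (1 / 128) *: (64 * x_ 0 ^+ 3 * x_ 4
                   - 16 * x_ 0 ^+ 2 * (2 * x_ 1 * x_ 3 + x_ 2 ^+ 2)
                   + 24 * x_ 0 * x_ 1 ^+ 2 * x_ 2 - 5 * x_ 1 ^+ 4) /\
   P 1%N 4%N =
     (1 / 32) *: (16 * x_ 0 ^+ 3 * x_ 5
                  - 8 * x_ 0 ^+ 2 * (x_ 1 * x_ 4 + x_ 2 * x_ 3)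
                  + 6 * x_ 0 * (x_ 1 ^+ 2 * x_ 3 + x_ 1 * x_ 2 ^+ 2)
                  - 5 * x_ 1 ^+ 3 * x_ 2) /\
   P 2%N 4%N =
     (1 / 32) *: (16 * x_ 0 ^+ 3 * x_ 6
                  - 4 * x_ 0 ^+ 2
                    * (2 * x_ 1 * x_ 5 + 2 * x_ 2 * x_ 4 + x_ 3 ^+ 2)
                  + 6 * x_ 0 * (x_ 1 ^+ 2 * x_ 4 + 2 * x_ 1 * x_ 2 * x_ 3)
                  - 5 * x_ 1 ^+ 3 * x_ 3) /\
   (forall m : nat, (3 <= m)%N ->
      P m 4%N =
        (1 / 32) *: (16 * x_ 0 ^+ 3 * x_ (m + 4)
                     - 8 * x_ 0 ^+ 2
                       * (x_ 1 * x_ (m + 3) + x_ 2 * x_ (m + 2)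
                          + x_ 3 * x_ (m + 1))
                     + 6 * x_ 0
                       * (x_ 1 ^+ 2 * x_ (m + 2) + 2 * x_ 1 * x_ 2 * x_ (m + 1))
                     - 5 * x_ 1 ^+ 3 * x_ (m + 1)))) /\
  (* (8); for k = 1 the truncated 2 * k - 3 is 0, and (-1)!! = 0!! = 1 *)
  ((forall k : nat, (0 < k)%N ->
      (P 0%N k).@[fun=> 1]
      = (double_fact (2 * k - 1))%:R / (double_fact (2 * k))%:R) /\
   (forall m k : nat, (0 < k)%N -> (k - 1 <= m)%N ->
      (P m k).@[fun=> 1]
      = (double_fact (2 * k - 3))%:R / (double_fact (2 * k - 2) * 2)%:R)) /\
  (* (9) *)
  ((forall k : nat, (0 < k)%N ->
      #|[set pi in partitions (0 + k) |
           (0 < largest_part pi)%N && (expansion_term F pi != 0)]|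
      = #|partitions k|) /\
   (forall m k : nat, (0 < k)%N -> (k - 1 <= m)%N ->
      #|[set pi in partitions (m + k) |
           (m < largest_part pi)%N && (expansion_term F pi != 0)]|
      = (\sum_(i < k) #|partitions i|)%N)).
Proof.
split; first by exists (sqrt_poly F); apply: sqrt_poly_family.
move=> P P_family.
have PE m k : (0 < k)%N -> P m k = sqrt_poly F m k.
  by move=> k_gt0; apply: sqrt_familyE.
split=> [m k k_gt0|].
  by rewrite PE //; split; [apply: sqrt_poly_homog | apply: sqrt_poly_isobaric].
split=> [m k k_gt0|]; first by rewrite PE // sqrt_polyE.
split=> [m k k_gt0|]; first by rewrite PE // -max_exponentE //;
  apply: sqrt_poly_lcm.
split=> [m n k|]; first by rewrite PE //; apply: sqrt_poly_integral.
split=> [n k|]; first by rewrite PE //; apply: sqrt_poly0_det.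
split=> [m n k le_km|]; first by rewrite PE //; apply: sqrt_poly_det_small.
split.
  split=> [m|]; first by rewrite PE //; apply: sqrt_poly_m1.
  split; first by rewrite PE //; apply: sqrt_poly_02.
  split=> [m m_ge|]; first by rewrite PE //; apply: sqrt_poly_m2.
  split; first by rewrite PE //; apply: sqrt_poly_03.
  split; first by rewrite PE //; apply: sqrt_poly_13.
  split=> [m m_ge|]; first by rewrite PE //; apply: sqrt_poly_m3.
  split; first by rewrite PE //; apply: sqrt_poly_04.
  split; first by rewrite PE //; apply: sqrt_poly_14.
  split; first by rewrite PE //; apply: sqrt_poly_24.
  by move=> m m_ge; rewrite PE //; apply: sqrt_poly_m4.
split; split.
- by move=> k k_gt0; rewrite PE //; apply: sqrt_poly0_ones.
- by move=> m k k_gt0 le_km; rewrite PE //; apply: sqrt_poly_ones.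
- exact: card_terms0.
- exact: card_terms.
Qed.
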